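(* Let $(\boldsymbol{J}_h^{n+1},\boldsymbol{u}_h^{n+1},\phi_h^{n+1},p_h^{n+1})$ be the solution of the fully discrete scheme (FD) described in the context, for $n=1,\ldots,N-1$. With the modified energy $\mathcal{E}_h^n$, the dissipation $\mathcal{D}_h^{n+1}$, the velocity coefficient vectors $\boldsymbol{\xi}_{\boldsymbol{u}}^n$ and the norm $\|\cdot\|_{\boldsymbol{Q}_{\boldsymbol{u}}^0}$ defined in the context, $$\frac{\mathcal{E}_h^{n+1}-\mathcal{E}_h^n}{\Delta t}+\frac{1}{4\Delta t}\left\|\boldsymbol{\xi}_{\boldsymbol{u}}^{n+1}-2\boldsymbol{\xi}_{\boldsymbol{u}}^{n}+\boldsymbol{\xi}_{\boldsymbol{u}}^{n-1}\right\|_{\boldsymbol{Q}_{\boldsymbol{u}}^0}^2+\mathcal{D}_h^{n+1}=\bigl(\rho_h^{n+1}\boldsymbol{f}_u^{n+1},\boldsymbol{u}_h^{n+1}\bigr)_{\Omega_h^{n+1}}.$$ In particular, if $\boldsymbol{f}_u=\boldsymbol{0}$, then $$\frac{\mathcal{E}_h^{n+1}-\mathcal{E}_h^n}{\Delta t}+\mathcal{D}_h^{n+1}\le0,$$ and hence $\mathcal{E}_h^{n+1}\le\mathcal{E}_h^n$.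
   Context: Initial mesh and spaces. Fix an integer $k\ge1$. $\widehat K$ is the reference tetrahedron, $P_r(\widehat K)$ the polynomials of total degree at most $r$, $\boldsymbol{P}_r(\widehat K)=[P_r(\widehat K)]^3$, and $\mathbf{BDM}_k(\widehat K)$ the standard local Brezzi–Douglas–Marini space of order $k$ (vector polynomials of degree at most $k$). $\Omega_h^0\subset\mathbb{R}^3$ is a bounded Lipschitz domain covered by a conforming curvilinear tetrahedral mesh $\mathcal{T}_h^0$; every $K_0\in\mathcal{T}_h^0$ is the image of $\widehat K$ under an orientation-preserving polynomial diffeomorphism $\boldsymbol{F}_{K_0}\in\boldsymbol{P}_{k+1}(\widehat K)$, these maps being compatible across common faces. Write $D\boldsymbol{F}_{K_0}$ for the Jacobian matrix and $\mathcal{J}_{K_0}=\det D\boldsymbol{F}_{K_0}>0$. Define - $\boldsymbol{W}_h^0$: all $\boldsymbol{\varphi}_h\in\boldsymbol{H}(\mathrm{div};\Omega_h^0)$ such that for each $K_0$, $\boldsymbol{\varphi}_h|_{K_0}\circ\boldsymbol{F}_{K_0}=\mathcal{J}_{K_0}^{-1}D\boldsymbol{F}_{K_0}\widehat{\boldsymbol{\varphi}}$ for some $\widehat{\boldsymbol{\varphi}}\in\mathbf{BDM}_k(\widehat K)$; - $\widetilde{\boldsymbol{V}}_h^0$: all $\boldsymbol{v}_h\in\boldsymbol{H}^1(\Omega_h^0)$ with $\boldsymbol{v}_h|_{K_0}\circ\boldsymbol{F}_{K_0}\in\boldsymbol{P}_{k+1}(\widehat K)$ for each $K_0$; $\boldsymbol{V}_h^0=\widetilde{\boldsymbol{V}}_h^0\cap\boldsymbol{H}_0^1(\Omega_h^0)$;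 - $S_h^0$: all $r_h\in L^2(\Omega_h^0)$ with $r_h|_{K_0}\circ\boldsymbol{F}_{K_0}\in P_{k-1}(\widehat K)$ for each $K_0$; - $Q_h^0$: all $q_h\in H^1(\Omega_h^0)$ with $q_h|_{K_0}\circ\boldsymbol{F}_{K_0}\in P_k(\widehat K)$ for each $K_0$. Moving meshes. Let $t^n=n\Delta t$, $\Delta t=T/N$, $n=0,\dots,N$. The discrete flow maps $\boldsymbol{M}_h^n\in\widetilde{\boldsymbol{V}}_h^0$ ($\boldsymbol{M}_h^0$ the identity) map $\Omega_h^0$ onto the domain $\Omega_h^n$ with mesh $\mathcal{T}_h^n=\{\boldsymbol{M}_h^n(K_0):K_0\in\mathcal{T}_h^0\}$; each $\boldsymbol{M}_h^n$ is a bi-Lipschitz bijection, restricting to an orientation-preserving diffeomorphism on each $K_0$, with $\mathcal{J}_{\boldsymbol{M}_h^n}:=\det(D\boldsymbol{M}_h^n)>0$, where $D\boldsymbol{M}_h^n$ is the Jacobian matrix. Spaces on $\Omega_h^n$: - $\boldsymbol{W}_h^n=\{\boldsymbol{\varphi}_h\in\boldsymbol{H}(\mathrm{div};\Omega_h^n):\boldsymbol{\varphi}_h\circ\boldsymbol{M}_h^n=\mathcal{J}_{\boldsymbol{M}_h^n}^{-1}D\boldsymbol{M}_h^n\,\boldsymbol{\varphi}_h^0,\ \boldsymbol{\varphi}_h^0\in\boldsymbol{W}_h^0\}$; - $\widetilde{\boldsymbol{V}}_h^n=\{\boldsymbol{v}_h\in\boldsymbol{H}^1(\Omega_h^n):\boldsymbol{v}_h\circ\boldsymbol{M}_h^n\in\widetilde{\boldsymbol{V}}_h^0\}$,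 $\boldsymbol{V}_h^n=\widetilde{\boldsymbol{V}}_h^n\cap\boldsymbol{H}^1_0(\Omega_h^n)$; - $S_h^n=\{r_h\in L^2(\Omega_h^n):r_h\circ\boldsymbol{M}_h^n\in S_h^0\}$; $Q_h^n=\{q_h\in H^1(\Omega_h^n):q_h\circ\boldsymbol{M}_h^n\in Q_h^0\}$. Coefficients. $\rho_h^0,\sigma_h^0,\nu_h^0$ are given bounded functions on $\Omega_h^0$, bounded below by positive constants, and $\rho_h^n\circ\boldsymbol{M}_h^n=\rho_h^0/\mathcal{J}_{\boldsymbol{M}_h^n}$, $\sigma_h^n\circ\boldsymbol{M}_h^n=\sigma_h^0$, $\nu_h^n\circ\boldsymbol{M}_h^n=\nu_h^0$. Constants: $\mathrm{Re}>0$, $\alpha\ge0$, $\beta>0$. $\boldsymbol{B}=\boldsymbol{B}(\boldsymbol{x})$ is a prescribed bounded field, $\boldsymbol{f}_u^{n+1}=\boldsymbol{f}_u(\cdot,t^{n+1})$ a prescribed body force, $\boldsymbol{D}(\boldsymbol{u})=\frac12(\nabla\boldsymbol{u}+\nabla\boldsymbol{u}^T)$, and $(\cdot,\cdot)_{\Omega}$ is the $L^2(\Omega)$ inner product. Scheme (FD). Given $\boldsymbol{u}_h^0\in\boldsymbol{V}_h^0$ and starting values $\boldsymbol{M}_h^1$, $\boldsymbol{u}_h^1\in\boldsymbol{V}_h^1$ (from a backward Euler step), for $n=1,\dots,N-1$ the flow map is advanced by $$\frac{\boldsymbol{M}_h^{n+1}-\boldsymbol{M}_h^n}{\Delta t}=\frac32\boldsymbol{u}_h^n\circ\boldsymbol{M}_h^n-\frac12\boldsymbol{u}_h^{n-1}\circ\boldsymbol{M}_h^{n-1}.$$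 For $m<n$ set $\boldsymbol{M}_h^{m,n}=\boldsymbol{M}_h^n\circ(\boldsymbol{M}_h^m)^{-1}$, $\widetilde{\boldsymbol{u}}_h^{\,n,m}=\boldsymbol{u}_h^m\circ(\boldsymbol{M}_h^{m,n})^{-1}\in\boldsymbol{V}_h^n$, and $$\Bigl(\frac{\delta\boldsymbol{u}_h}{\delta t}\Bigr)^{n+1}=\frac{3\boldsymbol{u}_h^{n+1}-4\widetilde{\boldsymbol{u}}_h^{\,n+1,n}+\widetilde{\boldsymbol{u}}_h^{\,n+1,n-1}}{2\Delta t}.$$ Then $(\boldsymbol{J}_h^{n+1},\boldsymbol{u}_h^{n+1},\phi_h^{n+1},p_h^{n+1})\in\boldsymbol{W}_h^{n+1}\times\boldsymbol{V}_h^{n+1}\times S_h^{n+1}\times Q_h^{n+1}$ satisfies, for all $\boldsymbol{\varphi}_h\in\boldsymbol{W}_h^{n+1}$, $\boldsymbol{v}_h\in\boldsymbol{V}_h^{n+1}$, $r_h\in S_h^{n+1}$, $q_h\in Q_h^{n+1}$ (all inner products over $\Omega_h^{n+1}$), $$((\sigma_h^{n+1})^{-1}\boldsymbol{J}_h^{n+1},\boldsymbol{\varphi}_h)-(\phi_h^{n+1},\nabla\cdot\boldsymbol{\varphi}_h)-(\boldsymbol{u}_h^{n+1}\times\boldsymbol{B},\boldsymbol{\varphi}_h)=0,$$ $$\Bigl(\rho_h^{n+1}\Bigl(\frac{\delta\boldsymbol{u}_h}{\delta t}\Bigr)^{n+1},\boldsymbol{v}_h\Bigr)+\frac1{\mathrm{Re}}(2\nu_h^{n+1}\boldsymbol{D}(\boldsymbol{u}_h^{n+1}),\boldsymbol{D}(\boldsymbol{v}_h))+\beta(\nabla\cdot\boldsymbol{u}_h^{n+1},\nabla\cdot\boldsymbol{v}_h)-(p_h^{n+1},\nabla\cdot\boldsymbol{v}_h)-\alpha(\boldsymbol{J}_h^{n+1}\times\boldsymbol{B},\boldsymbol{v}_h)=(\rho_h^{n+1}\boldsymbol{f}_u^{n+1},\boldsymbol{v}_h),$$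 $$-(\nabla\cdot\boldsymbol{J}_h^{n+1},r_h)=0,\qquad-(\nabla\cdot\boldsymbol{u}_h^{n+1},q_h)=0.$$ Energy quantities. Fix a basis $\{\boldsymbol{v}_j^0\}_{j=1}^{N_u}$ of $\boldsymbol{V}_h^0$ and let $\boldsymbol{v}_j^n\in\boldsymbol{V}_h^n$ be defined by $\boldsymbol{v}_j^n\circ\boldsymbol{M}_h^n=\boldsymbol{v}_j^0$. Write $\boldsymbol{u}_h^n=\sum_j\xi_{\boldsymbol{u},j}^n\boldsymbol{v}_j^n$ and $\boldsymbol{\xi}_{\boldsymbol{u}}^n=(\xi_{\boldsymbol{u},j}^n)_j\in\mathbb{R}^{N_u}$. Let $\boldsymbol{Q}_{\boldsymbol{u}}^0[i,j]=(\rho_h^0\boldsymbol{v}_j^0,\boldsymbol{v}_i^0)_{\Omega_h^0}$ and $\|\boldsymbol{\xi}\|_{\boldsymbol{Q}_{\boldsymbol{u}}^0}^2=\boldsymbol{\xi}^T\boldsymbol{Q}_{\boldsymbol{u}}^0\boldsymbol{\xi}$. For $n\ge1$, $$\mathcal{E}_h^n:=\frac14\Bigl(\|\boldsymbol{\xi}_{\boldsymbol{u}}^n\|_{\boldsymbol{Q}_{\boldsymbol{u}}^0}^2+\|2\boldsymbol{\xi}_{\boldsymbol{u}}^n-\boldsymbol{\xi}_{\boldsymbol{u}}^{n-1}\|_{\boldsymbol{Q}_{\boldsymbol{u}}^0}^2\Bigr),$$ $$\mathcal{D}_h^{n+1}:=\frac1{\mathrm{Re}}\bigl(2\nu_h^{n+1}\boldsymbol{D}(\boldsymbol{u}_h^{n+1}),\boldsymbol{D}(\boldsymbol{u}_h^{n+1})\bigr)_{\Omega_h^{n+1}}+\beta\|\nabla\cdot\boldsymbol{u}_h^{n+1}\|_{L^2(\Omega_h^{n+1})}^2+\alpha\bigl((\sigma_h^{n+1})^{-1}\boldsymbol{J}_h^{n+1},\boldsymbol{J}_h^{n+1}\bigr)_{\Omega_h^{n+1}}.$$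 *)

(* Defs.v *)
From HB Require Import structures.
From mathcomp Require Import all_boot all_order all_algebra perm.
From mathcomp Require Import all_classical all_reals all_analysis.

Set Implicit Arguments.
Unset Strict Implicit.
Unset Printing Implicit Defensive.

Import Order.TTheory GRing.Theory Num.Theory.
Import numFieldNormedType.Exports.

Local Open Scope classical_set_scope.
Local Open Scope ring_scope.

(* Vectors and points of R^3 are row vectors, as for the library's jacobian:
   'J f x is the transpose of the usual Jacobian matrix Df(x), so that
   Df(x) v is written v *m 'J f x. *)

Definition dot (R : realType) n (u v : 'rV[R]_n) : R := \sum_i u 0 i * v 0 i.

Definition frob (R : realType) n (A B : 'M[R]_n) : R :=
  \sum_i \sum_j A i j * B i j.

(* Indices are in 'I_3 = Z/3Z, hence cyclic. *)
Definition cross (R : realType) (u v : 'rV[R]_3) : 'rV[R]_3 :=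
  \row_i (u 0 (i + 1) * v 0 (i + 2) - u 0 (i + 2) * v 0 (i + 1)).

(* 'rV[R]_3 has no measurable structure in the library; it is identified with
   R * R * R and its product measure through pt3.  All functions are total and
   only their values on the domain at hand matter. *)

Definition leb3 (R : realType) :=
  ((@lebesgue_measure R \x @lebesgue_measure R) \x @lebesgue_measure R)%E.

Definition pt3 (R : realType)
  (p : measurableTypeR R * measurableTypeR R * measurableTypeR R) : 'rV[R]_3 :=
  \row_(i < 3) [:: p.1.1; p.1.2; p.2]`_i.

Definition ae_on (R : realType) (Om : set 'rV[R]_3) (P : 'rV[R]_3 -> Prop) : Prop :=
  {ae @leb3 R, forall p, Om (pt3 p) -> P (pt3 p)}.

Definition meas_on (R : realType) (Om : set 'rV[R]_3) (f : 'rV[R]_3 -> R) : Prop :=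
  measurable_fun (@pt3 R @^-1` Om) (f \o @pt3 R).

Definition meas_on_vec (R : realType) (Om : set 'rV[R]_3)
  (f : 'rV[R]_3 -> 'rV[R]_3) : Prop :=
  forall i, meas_on Om (fun x => f x 0 i).

Definition integral3 (R : realType) (Om : set 'rV[R]_3) (f : 'rV[R]_3 -> R) : R :=
  Rintegral (@leb3 R) (@pt3 R @^-1` Om) (f \o @pt3 R).

Definition L2 (R : realType) (Om : set 'rV[R]_3) (f : 'rV[R]_3 -> R) : Prop :=
  meas_on Om f /\
  (\int[@leb3 R]_(p in @pt3 R @^-1` Om) ((f (pt3 p)) ^+ 2)%:E < +oo)%E.

Definition L2_vec (R : realType) (Om : set 'rV[R]_3)
  (f : 'rV[R]_3 -> 'rV[R]_3) : Prop :=
  forall i, L2 Om (fun x => f x 0 i).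

Definition ip (R : realType) (Om : set 'rV[R]_3) (f g : 'rV[R]_3 -> R) : R :=
  integral3 Om (fun x => f x * g x).

Definition ip_vec (R : realType) (Om : set 'rV[R]_3)
  (f g : 'rV[R]_3 -> 'rV[R]_3) : R :=
  integral3 Om (fun x => dot (f x) (g x)).

Definition ip_mx (R : realType) (Om : set 'rV[R]_3)
  (f g : 'rV[R]_3 -> 'M[R]_3) : R :=
  integral3 Om (fun x => frob (f x) (g x)).

Definition pderiv (R : realType) (i : 'I_3) (f : 'rV[R]_3 -> R) : 'rV[R]_3 -> R :=
  fun x => 'D_(delta_mx 0 i) f x.

Definition grad (R : realType) (f : 'rV[R]_3 -> R) : 'rV[R]_3 -> 'rV[R]_3 :=
  fun x => \row_i pderiv i f x.

(* C_c^oo(Om): all iterated partial derivatives are differentiable. *)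
Definition test_fun (R : realType) (Om : set 'rV[R]_3) (psi : 'rV[R]_3 -> R) : Prop :=
  [/\ forall (s : seq 'I_3) x, differentiable (foldr (@pderiv R) psi s) x,
      compact (closure [set x | psi x != 0]) &
      closure [set x | psi x != 0] `<=` Om].

Definition is_weak_pderiv (R : realType) (Om : set 'rV[R]_3) (i : 'I_3)
  (f g : 'rV[R]_3 -> R) : Prop :=
  forall psi, test_fun Om psi -> ip Om f (pderiv i psi) = - ip Om g psi.

Definition is_weak_div (R : realType) (Om : set 'rV[R]_3)
  (f : 'rV[R]_3 -> 'rV[R]_3) (g : 'rV[R]_3 -> R) : Prop :=
  forall psi, test_fun Om psi -> ip_vec Om f (grad psi) = - ip Om g psi.

(* The weak derivatives, as square integrable functions; they are unique up to
   null sets, and a representative is chosen. *)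
Definition wpd (R : realType) (Om : set 'rV[R]_3) (i : 'I_3) (f : 'rV[R]_3 -> R) :
    'rV[R]_3 -> R :=
  get [set g : 'rV[R]_3 -> R | L2 Om g /\ is_weak_pderiv Om i f g].

Definition wdiv (R : realType) (Om : set 'rV[R]_3) (f : 'rV[R]_3 -> 'rV[R]_3) :
    'rV[R]_3 -> R :=
  get [set g : 'rV[R]_3 -> R | L2 Om g /\ is_weak_div Om f g].

Definition wgrad (R : realType) (Om : set 'rV[R]_3) (u : 'rV[R]_3 -> 'rV[R]_3) :
    'rV[R]_3 -> 'M[R]_3 :=
  fun x => \matrix_(i, j) wpd Om j (fun y => u y 0 i) x.

Definition symgrad (R : realType) (Om : set 'rV[R]_3) (u : 'rV[R]_3 -> 'rV[R]_3) :
    'rV[R]_3 -> 'M[R]_3 :=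
  fun x => 2^-1 *: (wgrad Om u x + (wgrad Om u x)^T).

Definition H1 (R : realType) (Om : set 'rV[R]_3) (f : 'rV[R]_3 -> R) : Prop :=
  L2 Om f /\ forall i, exists g, L2 Om g /\ is_weak_pderiv Om i f g.

Definition H1_vec (R : realType) (Om : set 'rV[R]_3)
  (u : 'rV[R]_3 -> 'rV[R]_3) : Prop :=
  forall i, H1 Om (fun x => u x 0 i).

Definition Hdiv (R : realType) (Om : set 'rV[R]_3)
  (f : 'rV[R]_3 -> 'rV[R]_3) : Prop :=
  L2_vec Om f /\ exists g, L2 Om g /\ is_weak_div Om f g.

Definition H1_sqnorm (R : realType) (Om : set 'rV[R]_3) (f : 'rV[R]_3 -> R) : R :=
  ip Om f f + \sum_i ip Om (wpd Om i f) (wpd Om i f).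

(* H^1_0(Om) is the closure of C_c^oo(Om) in H^1(Om). *)
Definition H10 (R : realType) (Om : set 'rV[R]_3) (f : 'rV[R]_3 -> R) : Prop :=
  H1 Om f /\
  forall e : R, 0 < e ->
    exists psi, test_fun Om psi /\ H1_sqnorm Om (fun x => f x - psi x) < e.

Definition H10_vec (R : realType) (Om : set 'rV[R]_3)
  (u : 'rV[R]_3 -> 'rV[R]_3) : Prop :=
  forall i, H10 Om (fun x => u x 0 i).

(* Near each boundary point, in suitable orthonormal coordinates y centred at
   that point, Om is the region above the graph of a Lipschitz function. *)
Definition lipschitz_domain (R : realType) (Om : set 'rV[R]_3) : Prop :=
  [/\ open Om, connected Om, Om !=set0, bounded_set Om &
    forall x0, (closure Om `\` Om) x0 ->
      exists (A : 'M[R]_3) (g : 'rV[R]_2 -> R) (r : R),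
        [/\ A *m A^T = 1%:M, [lipschitz g y | y in setT], 0 < r &
          forall z, `|z - x0| < r ->
            (Om z <-> let y := (z - x0) *m A in
                      g (col' ord_max y) < y 0 ord_max)]].

Definition C1_on (R : realType) (U : set 'rV[R]_3) (f : 'rV[R]_3 -> 'rV[R]_3) : Prop :=
  forall x, U x -> differentiable f x /\ {for x, continuous (fun y => 'J f y)}.

(* A need not be open (it is a closed curvilinear tetrahedron below): f is, on A,
   the restriction of a C^1 diffeomorphism between open sets. *)
Definition or_diffeo_on (R : realType) (A : set 'rV[R]_3)
  (f : 'rV[R]_3 -> 'rV[R]_3) : Prop :=
  exists (ft g : 'rV[R]_3 -> 'rV[R]_3) (U V : set 'rV[R]_3),
    [/\ [/\ open U, open V & A `<=` U],
        [/\ C1_on U ft, C1_on V g, set_fun U V ft & set_fun V U g],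
        {in U, cancel ft g}, {in V, cancel g ft} &
        forall x, A x -> ft x = f x /\ 0 < \det ('J ft x)].

Definition bilipschitz_on (R : realType) (A : set 'rV[R]_3)
  (f : 'rV[R]_3 -> 'rV[R]_3) : Prop :=
  exists2 L : R, 0 < L & forall x y, A x -> A y ->
    L^-1 * `|x - y| <= `|f x - f y| <= L * `|x - y|.

(* The vertices are numbered by 'I_4: the origin, then the canonical basis. *)
Definition vertex (R : realType) (i : 'I_4) : 'rV[R]_3 :=
  if unlift ord0 i is Some j then delta_mx 0 j else 0.

Definition bary (R : realType) (x : 'rV[R]_3) (i : 'I_4) : R :=
  if unlift ord0 i is Some j then x 0 j else 1 - \sum_j x 0 j.

Definition Khat (R : realType) : set 'rV[R]_3 :=
  [set x | forall i, 0 <= bary x i].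

Definition subsimplex (R : realType) (I : {set 'I_4}) : set 'rV[R]_3 :=
  [set x | Khat x /\ forall i, i \notin I -> bary x i = 0].

(* The affine map sending the vertex i to the vertex s i. *)
Definition vertex_map (R : realType) (s : {perm 'I_4}) (x : 'rV[R]_3) : 'rV[R]_3 :=
  \sum_i bary x i *: vertex R (s i).

(* P_r: total degree at most r. *)
Definition is_poly (R : realType) (r : nat) (f : 'rV[R]_3 -> R) : Prop :=
  exists c : {ffun 'I_3 -> 'I_r.+1} -> R, forall x,
    f x = \sum_(a : {ffun 'I_3 -> 'I_r.+1} | (\sum_i a i <= r)%N)
            c a * \prod_i x 0 i ^+ a i.

Definition is_poly_vec (R : realType) (r : nat) (f : 'rV[R]_3 -> 'rV[R]_3) : Prop :=
  forall i, is_poly r (fun x => f x 0 i).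

(* The space BDM_k on the reference tetrahedron is all of [P_k]^3. *)
Definition BDM (R : realType) (k : nat) (f : 'rV[R]_3 -> 'rV[R]_3) : Prop :=
  is_poly_vec k f.

(* Two distinct elements meet along a common (possibly empty) subsimplex,
   of dimension at most 2, on which their parametrizations agree up to a
   renumbering of the vertices. *)
Definition curvilinear_mesh (R : realType) (k : nat) (Om : set 'rV[R]_3) (m : nat)
  (F : 'I_m -> 'rV[R]_3 -> 'rV[R]_3) : Prop :=
  [/\ forall K, is_poly_vec k.+1 (F K),
      forall K, or_diffeo_on (@Khat R) (F K),
      closure Om = \bigcup_K (F K @` @Khat R) &
      forall K K', K != K' ->
        exists (I : {set 'I_4}) (s : {perm 'I_4}),
          [/\ I != [set: 'I_4]%SET,
              (F K @` @Khat R) `&` (F K' @` @Khat R) = F K @` subsimplex I &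
              forall x, subsimplex I x -> F K x = F K' (vertex_map s x)]].

(* Elements of H(div) and L^2 are classes modulo null sets, and their elementwise
   description holds almost everywhere.  Piecewise polynomial H^1 functions
   are identified with their continuous representative on the closed
   domain, so that their elementwise description holds at every point. *)

Definition W0 (R : realType) (k : nat) (Om : set 'rV[R]_3) (m : nat)
  (F : 'I_m -> 'rV[R]_3 -> 'rV[R]_3) (phi : 'rV[R]_3 -> 'rV[R]_3) : Prop :=
  Hdiv Om phi /\
  forall K, exists2 phihat, BDM k phihat &
    ae_on (@Khat R) (fun x =>
      phi (F K x) = (\det ('J (F K) x))^-1 *: (phihat x *m 'J (F K) x)).

Definition Vt0 (R : realType) (k : nat) (Om : set 'rV[R]_3) (m : nat)
  (F : 'I_m -> 'rV[R]_3 -> 'rV[R]_3) (v : 'rV[R]_3 -> 'rV[R]_3) : Prop :=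
  H1_vec Om v /\
  forall K, exists2 p, is_poly_vec k.+1 p &
    forall x, Khat x -> v (F K x) = p x.

Definition V0 (R : realType) (k : nat) (Om : set 'rV[R]_3) (m : nat)
  (F : 'I_m -> 'rV[R]_3 -> 'rV[R]_3) (v : 'rV[R]_3 -> 'rV[R]_3) : Prop :=
  Vt0 k Om F v /\ H10_vec Om v.

Definition S0 (R : realType) (k : nat) (Om : set 'rV[R]_3) (m : nat)
  (F : 'I_m -> 'rV[R]_3 -> 'rV[R]_3) (r : 'rV[R]_3 -> R) : Prop :=
  L2 Om r /\
  forall K, exists2 p, is_poly k.-1 p &
    ae_on (@Khat R) (fun x => r (F K x) = p x).

Definition Q0 (R : realType) (k : nat) (Om : set 'rV[R]_3) (m : nat)
  (F : 'I_m -> 'rV[R]_3 -> 'rV[R]_3) (q : 'rV[R]_3 -> R) : Prop :=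
  H1 Om q /\
  forall K, exists2 p, is_poly k p & forall x, Khat x -> q (F K x) = p x.

(* The moved domain is M @` Om. *)
Definition flow_map (R : realType) (k : nat) (Om : set 'rV[R]_3) (m : nat)
  (F : 'I_m -> 'rV[R]_3 -> 'rV[R]_3) (M : 'rV[R]_3 -> 'rV[R]_3) : Prop :=
  [/\ Vt0 k Om F M, bilipschitz_on (closure Om) M, open (M @` Om) &
      forall K, or_diffeo_on (F K @` @Khat R) M].

Definition Wn (R : realType) (k : nat) (Om : set 'rV[R]_3) (m : nat)
  (F : 'I_m -> 'rV[R]_3 -> 'rV[R]_3) (M : 'rV[R]_3 -> 'rV[R]_3)
  (phi : 'rV[R]_3 -> 'rV[R]_3) : Prop :=
  Hdiv (M @` Om) phi /\
  exists2 phi0, W0 k Om F phi0 &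
    ae_on Om (fun x => phi (M x) = (\det ('J M x))^-1 *: (phi0 x *m 'J M x)).

Definition Vtn (R : realType) (k : nat) (Om : set 'rV[R]_3) (m : nat)
  (F : 'I_m -> 'rV[R]_3 -> 'rV[R]_3) (M : 'rV[R]_3 -> 'rV[R]_3)
  (v : 'rV[R]_3 -> 'rV[R]_3) : Prop :=
  H1_vec (M @` Om) v /\ Vt0 k Om F (v \o M).

Definition Vn (R : realType) (k : nat) (Om : set 'rV[R]_3) (m : nat)
  (F : 'I_m -> 'rV[R]_3 -> 'rV[R]_3) (M : 'rV[R]_3 -> 'rV[R]_3)
  (v : 'rV[R]_3 -> 'rV[R]_3) : Prop :=
  Vtn k Om F M v /\ H10_vec (M @` Om) v.

Definition Sn (R : realType) (k : nat) (Om : set 'rV[R]_3) (m : nat)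
  (F : 'I_m -> 'rV[R]_3 -> 'rV[R]_3) (M : 'rV[R]_3 -> 'rV[R]_3)
  (r : 'rV[R]_3 -> R) : Prop :=
  L2 (M @` Om) r /\ S0 k Om F (r \o M).

Definition Qn (R : realType) (k : nat) (Om : set 'rV[R]_3) (m : nat)
  (F : 'I_m -> 'rV[R]_3 -> 'rV[R]_3) (M : 'rV[R]_3 -> 'rV[R]_3)
  (q : 'rV[R]_3 -> R) : Prop :=
  H1 (M @` Om) q /\ Q0 k Om F (q \o M).

Definition initial_coef (R : realType) (Om : set 'rV[R]_3) (c : 'rV[R]_3 -> R) : Prop :=
  meas_on Om c /\
  exists a b : R, 0 < a /\ forall x, Om x -> a <= c x <= b.

Definition coef_transported (R : realType) (Om : set 'rV[R]_3)
  (M : 'rV[R]_3 -> 'rV[R]_3) (c0 c : 'rV[R]_3 -> R) : Prop :=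
  meas_on (M @` Om) c /\ forall x, Om x -> c (M x) = c0 x.

(* 'J M is only meaningful inside the elements, hence the almost everywhere condition. *)
Definition density_transported (R : realType) (Om : set 'rV[R]_3)
  (M : 'rV[R]_3 -> 'rV[R]_3) (c0 c : 'rV[R]_3 -> R) : Prop :=
  meas_on (M @` Om) c /\ ae_on Om (fun x => c (M x) = c0 x / \det ('J M x)).

(* M^{a,b} = M^b o (M^a)^{-1} : Om^a -> Om^b *)
Definition flow_between (R : realType) (Om : set 'rV[R]_3)
  (M : nat -> 'rV[R]_3 -> 'rV[R]_3) (a b : nat) : 'rV[R]_3 -> 'rV[R]_3 :=
  M b \o pinv Om (M a).

(* u^a o (M^{a,b})^{-1} *)
Definition transported (R : realType) (Om : set 'rV[R]_3)
  (M u : nat -> 'rV[R]_3 -> 'rV[R]_3) (b a : nat) : 'rV[R]_3 -> 'rV[R]_3 :=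
  u a \o pinv (M a @` Om) (flow_between Om M a b).

Definition bdf2 (R : realType) (Om : set 'rV[R]_3)
  (M u : nat -> 'rV[R]_3 -> 'rV[R]_3) (dt : R) (n : nat) : 'rV[R]_3 -> 'rV[R]_3 :=
  fun y => (2 * dt)^-1 *: (3 *: u n.+1 y - 4 *: transported Om M u n.+1 n y
                           + transported Om M u n.+1 n.-1 y).

Definition flow_step (R : realType) (Om : set 'rV[R]_3)
  (M u : nat -> 'rV[R]_3 -> 'rV[R]_3) (dt : R) (n : nat) : Prop :=
  forall x, Om x ->
    dt^-1 *: (M n.+1 x - M n x) =
    (3 / 2) *: u n (M n x) - 2^-1 *: u n.-1 (M n.-1 x).

Definition ohm_eq (R : realType) (Om : set 'rV[R]_3) (B : 'rV[R]_3 -> 'rV[R]_3)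
  (sigma : 'rV[R]_3 -> R) (J u : 'rV[R]_3 -> 'rV[R]_3) (phi : 'rV[R]_3 -> R)
  (psi : 'rV[R]_3 -> 'rV[R]_3) : Prop :=
  ip_vec Om (fun x => (sigma x)^-1 *: J x) psi
  - ip Om phi (wdiv Om psi)
  - ip_vec Om (fun x => cross (u x) (B x)) psi = 0.

Definition momentum_eq (R : realType) (Om : set 'rV[R]_3) (Re alpha beta : R)
  (B : 'rV[R]_3 -> 'rV[R]_3) (rho nu : 'rV[R]_3 -> R)
  (f du J u : 'rV[R]_3 -> 'rV[R]_3) (p : 'rV[R]_3 -> R)
  (v : 'rV[R]_3 -> 'rV[R]_3) : Prop :=
  ip_vec Om (fun x => rho x *: du x) v
  + Re^-1 * ip_mx Om (fun x => (2 * nu x) *: symgrad Om u x) (symgrad Om v)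
  + beta * ip Om (wdiv Om u) (wdiv Om v)
  - ip Om p (wdiv Om v)
  - alpha * ip_vec Om (fun x => cross (J x) (B x)) v
  = ip_vec Om (fun x => rho x *: f x) v.

Definition fd_solution (R : realType) (k : nat) (Om : set 'rV[R]_3) (m : nat)
  (F : 'I_m -> 'rV[R]_3 -> 'rV[R]_3) (M : 'rV[R]_3 -> 'rV[R]_3)
  (Re alpha beta : R) (B : 'rV[R]_3 -> 'rV[R]_3)
  (rho sigma nu : 'rV[R]_3 -> R) (f du J u : 'rV[R]_3 -> 'rV[R]_3)
  (phi p : 'rV[R]_3 -> R) : Prop :=
  let OmM := M @` Om in
  [/\ [/\ Wn k Om F M J, Vn k Om F M u, Sn k Om F M phi & Qn k Om F M p],
      forall psi, Wn k Om F M psi -> ohm_eq OmM B sigma J u phi psi,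
      forall v, Vn k Om F M v ->
        momentum_eq OmM Re alpha beta B rho nu f du J u p v,
      forall r, Sn k Om F M r -> - ip OmM (wdiv OmM J) r = 0 &
      forall q, Qn k Om F M q -> - ip OmM (wdiv OmM u) q = 0].

Definition is_basis (R : realType) (Om : set 'rV[R]_3)
  (V : ('rV[R]_3 -> 'rV[R]_3) -> Prop) (d : nat)
  (b : 'I_d -> 'rV[R]_3 -> 'rV[R]_3) : Prop :=
  [/\ forall j, V (b j),
      forall c : 'cV[R]_d,
        (forall x, Om x -> \sum_j c j 0 *: b j x = 0) -> c = 0 &
      forall v, V v ->
        exists c : 'cV[R]_d, forall x, Om x -> v x = \sum_j c j 0 *: b j x].

(* v_j^n, defined on closure Om^n by v_j^n o M^n = v_j^0 *)
Definition pushed (R : realType) (Om : set 'rV[R]_3) (M v0 : 'rV[R]_3 -> 'rV[R]_3) :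
    'rV[R]_3 -> 'rV[R]_3 :=
  v0 \o pinv (closure Om) M.

Definition gram (R : realType) (Om : set 'rV[R]_3) (rho0 : 'rV[R]_3 -> R) (d : nat)
  (b : 'I_d -> 'rV[R]_3 -> 'rV[R]_3) : 'M[R]_d :=
  \matrix_(i, j) ip_vec Om (fun x => rho0 x *: b j x) (b i).

Definition sqnorm (R : realType) (d : nat) (Q : 'M[R]_d) (xi : 'cV[R]_d) : R :=
  (xi^T *m Q *m xi) 0 0.

Definition energy (R : realType) (d : nat) (Q : 'M[R]_d) (xi : nat -> 'cV[R]_d)
  (n : nat) : R :=
  4^-1 * (sqnorm Q (xi n) + sqnorm Q (2 *: xi n - xi n.-1)).

Definition dissipation (R : realType) (Om : set 'rV[R]_3) (Re alpha beta : R)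
  (sigma nu : 'rV[R]_3 -> R) (J u : 'rV[R]_3 -> 'rV[R]_3) : R :=
  Re^-1 * ip_mx Om (fun x => (2 * nu x) *: symgrad Om u x) (symgrad Om u)
  + beta * ip Om (wdiv Om u) (wdiv Om u)
  + alpha * ip_vec Om (fun x => (sigma x)^-1 *: J x) J.

(* Main.v *)
Require Import Defs.
From HB Require Import structures.
From mathcomp Require Import all_boot all_order all_algebra perm.
From mathcomp Require Import all_classical all_reals all_analysis.
From mathcomp Require Import measurable_realfun ring lra.

Set Implicit Arguments.
Unset Strict Implicit.
Unset Printing Implicit Defensive.

Import Order.TTheory GRing.Theory Num.Theory.
Import numFieldNormedType.Exports.

Local Open Scope classical_set_scope.
Local Open Scope ring_scope.

(** The identity is the BDF2 energy identity, and it holds exactly because the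
    kinetic energy lives on a fixed domain.  Testing the scheme with its own
    solution (Ohm's law with J multiplied by alpha, the momentum equation with
    u, the two constraints with phi and p) makes the Lorentz terms cancel, since
    (J x B) . u = - (u x B) . J pointwise, and leaves
<<
      (rho (delta u / delta t), u) + D = (rho f, u)     on Omega^{n+1}
>>
    ([fd_energy_balance]).  The velocity at time n, followed along the flow, is
    the combination of the initial basis functions with coefficients xi^n, and
    the density satisfies (rho o M) det DM = rho^0; hence the change of variables
    y = M^{n+1}(x) turns the first term into the bilinear form of the Gram matrix
    on the initial domain ([transported_kinetic]):
<<
      (2 dt)^{-1} Q(xi^{n+1}, 3 xi^{n+1} - 4 xi^n + xi^{n-1}).
>>
    The BDF2 polarization identity ([bdf2_energy_identity]) rewrites this number
    as the difference of the energies plus the square of the second difference.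
    For f = 0 the rest is positivity of Q and of the dissipation.

    The substance is the change of variables ([flow_transport]), which is built
    here from Fubini's theorem.  Volume is first shown to be multiplied by
    |det A| under a linear map A, by LUP factorization into permutations and
    matrices that replace a single coordinate ([scales_volume_unitmx]).  For a C^1
    diffeomorphism f with inverse g, the two measures E |-> vol (f(E)) and
    E |-> int_E |det Df| are then compared on boxes.  If they differed on a box,
    repeated halving ([bisection]) would produce boxes shrinking to a point x on
    which they still differ by a fixed proportion of the volume.  But
    differentiability of f at x and of g at f(x) encloses the image of a small
    box between two affine images of slightly smaller and slightly larger boxes
    ([local_image_volume]), so the proportion tends to 0.  Boxes determine a
    measure, and so the measures agree ([image_measure_jacobian]).

    The flow map is C^1 only inside the elements of the mesh.  The faces of the
    reference tetrahedron are null, and C^1 diffeomorphisms preserve null sets,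
    so that neither the skeleton of the mesh nor its image by the flow carries
    any mass, and the change of variables may be made on the open set of interior
    points of the elements ([smooth_part]). *)

(** * Lebesgue measure on row vectors and its determination by boxes *)

(** The inverse of [pt3].  Its codomain is spelled with [measurableTypeR] so that
    it carries the product sigma-algebra. *)
Definition un3 (R : realType) (x : 'rV[R]_3) :
  measurableTypeR R * measurableTypeR R * measurableTypeR R := (x 0 0, x 0 1, x 0 2).

Lemma pt3K (R : realType) : cancel (@pt3 R) (@un3 R).
Proof. by move=> [[x y] z]; rewrite /un3 /pt3 !mxE /=. Qed.

Lemma ord3P (P : 'I_3 -> Prop) : P 0 -> P 1 -> P 2 -> forall i, P i.
Proof.
move=> P0 P1 P2 [[|[|[|//]]] h].
- by rewrite (_ : Ordinal h = 0)//; exact/val_inj.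
- by rewrite (_ : Ordinal h = 1)//; exact/val_inj.
- by rewrite (_ : Ordinal h = 2)//; exact/val_inj.
Qed.

Lemma un3K (R : realType) : cancel (@un3 R) (@pt3 R).
Proof.
by move=> x; apply/rowP; apply: ord3P; rewrite /un3 /pt3 !mxE /=.
Qed.

Fact row3_display : measure_display. Proof. exact. Qed.

Section row3.
Variable R : realType.

(** The sigma-algebra transported along [pt3] lets measures and integrals be
    considered directly on row vectors, where differentiation takes place. *)
Definition measurable_row3_set : set (set 'rV[R]_3) :=
  [set A | measurable (@pt3 R @^-1` A)].
Lemma row3_set_measurable0 : measurable_row3_set set0.
Proof. by rewrite /measurable_row3_set /= preimage_set0; exact: measurable0. Qed.
Lemma row3_set_measurableC A : measurable_row3_set A -> measurable_row3_set (~` A).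
Proof. by rewrite /measurable_row3_set /= preimage_setC; exact: measurableC. Qed.
Lemma row3_set_measurable_bigcup (F : (set 'rV[R]_3)^nat) : (forall i, measurable_row3_set (F i)) ->
  measurable_row3_set (\bigcup_i (F i)).
Proof. by rewrite /measurable_row3_set /= preimage_bigcup => mF; exact: bigcupT_measurable. Qed.

HB.instance Definition _ := @isMeasurable.Build row3_display 'rV[R]_3 measurable_row3_set
  row3_set_measurable0 row3_set_measurableC row3_set_measurable_bigcup.

Lemma measurable_pt3 : measurable_fun setT (@pt3 R).
Proof. by move=> _ A mA; rewrite setTI. Qed.

Definition vol : set 'rV[R]_3 -> \bar R := pushforward (@leb3 R) (@pt3 R).

HB.instance Definition _ := Measure.on (@leb3 R).

Let vol0 : vol set0 = 0%E.
Proof. by rewrite /vol /pushforward preimage_set0 measure0. Qed.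

Let vol_ge0 A : (0 <= vol A)%E.
Proof. by rewrite /vol /pushforward; exact: (measure_ge0 (@leb3 R)). Qed.

Let vol_sigma_additive : semi_sigma_additive vol.
Proof.
move=> F mF tF mUF; rewrite /vol /pushforward preimage_bigcup.
apply: measure_semi_sigma_additive => //.
- apply/trivIsetP => /= i j _ _ ij; rewrite -preimage_setI.
  by move/trivIsetP : tF => /(_ _ _ _ _ ij) ->//; rewrite preimage_set0.
Qed.

HB.instance Definition _ := isMeasure.Build _ _ _ vol vol0 vol_ge0 vol_sigma_additive.
End row3.

Section box.
Variable R : realType.

Implicit Types a b x : 'rV[R]_3.

Definition box a b : set 'rV[R]_3 :=
  [set x | forall i, a 0 i <= x 0 i < b 0 i].

Lemma pt3_box a b : @pt3 R @^-1` box a b =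
  (`[a 0 0, b 0 0[%classic `*` `[a 0 1, b 0 1[%classic) `*` `[a 0 2, b 0 2[%classic.
Proof.
apply/seteqP; split => -[[x y] z]; rewrite /box /pt3 /=.
  move=> h; move: (h 0) (h 1) (h 2); rewrite !mxE/=.
  by rewrite !in_itv/= => -> -> ->.
by rewrite !in_itv/= => -[[? ?] ?]; apply: ord3P; rewrite mxE.
Qed.

Lemma measurable_box a b : measurable (box a b).
Proof.
rewrite /measurable/= /measurable_row3_set/= pt3_box.
by apply: measurableX => //; apply: measurableX.
Qed.

Lemma vol_box a b : (forall i, a 0 i <= b 0 i) ->
  vol (box a b) = (\prod_i (b 0 i - a 0 i))%:E.
Proof.
move=> ab; rewrite /vol /pushforward pt3_box /leb3.
have itvE (c d : R) : c <= d -> lebesgue_measure `[c, d[%classic = (d - c)%:E.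
  move=> cd; rewrite lebesgue_measure_itv/= lte_fin; case: ltP => // dc.
  by rewrite (_ : d = c) ?subrr//; apply/le_anti/andP.
rewrite product_measure1E//; last exact: measurableX.
rewrite [X in (X * _)%E]product_measure1E//= !itvE// -!EFinM.
rewrite !big_ord_recr big_ord0 /= mul1r.
by congr (_ * _ * _)%:E; congr (b _ _ - a _ _); exact/val_inj.
Qed.

(** A product of three sets one of which is a point; the infinite measure of the
    other factors does not matter since oo * 0 = 0. *)
Lemma vol_plane (i : 'I_3) (t : R) : measurable [set x : 'rV[R]_3 | x 0 i = t] /\
  vol [set x : 'rV[R]_3 | x 0 i = t] = 0%E.
Proof.
rewrite /vol /pushforward /measurable/= /measurable_row3_set/=.
move: i; apply: ord3P.
- rewrite (_ : _ @^-1` _ = ([set t] `*` setT) `*` setT); last first.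
    by apply/seteqP; split => -[[x y] z]; rewrite /= mxE//= => -[[]].
  split; first by apply: measurableX => //; apply: measurableX.
  rewrite /leb3 product_measure1E//; last exact: measurableX.
  rewrite [X in (X * _)%E]product_measure1E//= ?lebesgue_measure_set1.
  by rewrite ?mul0e.
- rewrite (_ : _ @^-1` _ = (setT `*` [set t]) `*` setT); last first.
    by apply/seteqP; split => -[[x y] z]; rewrite /= mxE//= => -[[]].
  split; first by apply: measurableX => //; apply: measurableX.
  rewrite /leb3 product_measure1E//; last exact: measurableX.
  by rewrite [X in (X * _)%E]product_measure1E//= lebesgue_measure_set1 mule0 mul0e.
- rewrite (_ : _ @^-1` _ = setT `*` [set t]); last first.
    by apply/seteqP; split => -[[x y] z]; rewrite /= mxE//= => -[].
  split; first exact: measurableX.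
  rewrite /leb3 product_measure1E//=.
  by rewrite lebesgue_measure_set1 mule0.
Qed.

Lemma boxI a b c d : box a b `&` box c d =
  box (\row_i Num.max (a 0 i) (c 0 i)) (\row_i Num.min (b 0 i) (d 0 i)).
Proof.
apply/seteqP; split => x /=.
  move=> [h1 h2] i; rewrite !mxE ge_max lt_min.
  by case/andP: (h1 i) => -> ->; case/andP: (h2 i) => -> ->.
move=> h; split => i; move: (h i); rewrite !mxE ge_max lt_min;
by move=> /andP[/andP[? ?] /andP[? ?]]; apply/andP.
Qed.

Definition boxes : set (set 'rV[R]_3) := [set A | exists a b, A = box a b].

(** Bounds are [n.+1] rather than [n] so that no cube of this exhaustion is empty. *)
Definition ccube (n : nat) : set 'rV[R]_3 := box (const_mx (- n.+1%:R)) (const_mx n.+1%:R).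

Lemma bigcup_ccube : \bigcup_k (ccube k) = setT.
Proof.
apply/seteqP; split => // x _.
have [k kx] : exists k : nat, forall i, `|x 0 i| < k%:R.
  exists (Num.bound (\sum_i `|x 0 i|)) => i.
  apply: le_lt_trans (archi_boundP _); last by apply: sumr_ge0.
  by rewrite (bigD1 i)//= lerDl sumr_ge0.
exists k => // i; rewrite !mxE.
have : `|x 0 i| < k.+1%:R by rewrite (lt_trans (kx i))// ltr_nat.
by rewrite ltr_norml => /andP[h1 ->]; rewrite ltW.
Qed.

(** A half-space is a countable union of boxes.  These half-spaces make the
    coordinates measurable, which is all that the sigma-algebra amounts to. *)
Lemma boxes_coord (i : 'I_3) (r : R) : <<s boxes >> [set x : 'rV[R]_3 | r <= x 0 i].
Proof.
have -> : [set x : 'rV[R]_3 | r <= x 0 i] =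
    \bigcup_k box (\row_j if j == i then r else - k.+1%:R) (const_mx k.+1%:R); last first.
  apply: sigma_algebra_bigcup => k; apply: sub_sigma_algebra.
  by exists (\row_j if j == i then r else - k.+1%:R), (const_mx k.+1%:R).
apply/seteqP; split => x /=.
  move=> rx; have : [set: 'rV[R]_3] x by [].
  rewrite -bigcup_ccube => -[k _ kx]; exists k => // j; rewrite !mxE.
  move: (kx j); rewrite !mxE => /andP[h ->]; rewrite andbT.
  by case: eqP => [->|].
by move=> [k _ /(_ i)]; rewrite !mxE eqxx => /andP[].
Qed.

Lemma measurable_boxes : @measurable _ 'rV[R]_3 = <<s boxes >>.
Proof.
apply/seteqP; split; last first.
  apply: smallest_sub; first exact: sigma_algebra_measurable.
  by move=> _ [a [b ->]]; exact: measurable_box.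
move=> A mA.
pose T := g_sigma_algebraType boxes.
have mun3 : measurable_fun setT (@un3 R : T -> _).
  have mc (i : 'I_3) : measurable_fun setT ((fun x => x 0 i) : T -> measurableTypeR R).
    apply: (measurability _ (RGenCInfty.measurableE R)) => _ [_ [r ->] <-].
    rewrite setTI (_ : _ @^-1` _ = [set x : 'rV[R]_3 | r <= x 0 i]); first exact: boxes_coord.
    by apply/seteqP; split => x /=; rewrite in_itv/= andbT.
  by apply: measurable_fun_pair; [apply: measurable_fun_pair|]; exact: mc.
have := mun3 measurableT _ mA; rewrite setTI -comp_preimage.
by rewrite (_ : @pt3 R \o un3 (R:=R) = id)//; apply/funext => x /=; rewrite un3K.
Qed.

(** Boxes form a generating pi-system. *)
Lemma boxes_unique (m1 m2 : {measure set 'rV[R]_3 -> \bar R}) :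
  (forall a b, (forall i, a 0 i < b 0 i) -> m1 (box a b) = m2 (box a b)) ->
  (forall n, (m1 (ccube n) < +oo)%E) ->
  forall A, measurable A -> m1 A = m2 A.
Proof.
move=> m12 m1oo A mA; apply: (measure_unique boxes ccube) => //.
- exact: measurable_boxes.
- by move=> _ _ [a [b ->]] [c [d ->]]; rewrite boxI; eexists; eexists.
- by move=> i; rewrite /ccube; eexists; eexists.
- exact: bigcup_ccube.
- move=> _ [a [b ->]]; have [|] := pselect (forall i, a 0 i < b 0 i); first exact: m12.
  move/existsNP => [i /negP]; rewrite -leNgt => ba.
  rewrite (_ : box a b = set0) ?measure0//.
  apply/seteqP; split => // x /(_ i) /andP[ax xb].
  by have := le_lt_trans ax (lt_le_trans xb ba); rewrite ltxx.
Qed.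

End box.

(** * The effect of affine maps on volume *)

Notation pushed_measure m mf :=
  (measure_function_pushforward__canonical__measure_function_Measure m mf).
Notation restricted m mD :=
  (measure_function_mrestr__canonical__measure_function_Measure m mD).

Section affine1.
Variable R : realType.

(** It suffices to compare the two sides on half-open intervals. *)
Lemma lebesgue_affine (c t : R) : c != 0 ->
  forall B : set (measurableTypeR R), measurable B ->
  (`|c|%:E * lebesgue_measure ((fun z : measurableTypeR R => (c * z + t)%R) @^-1` B) =
   lebesgue_measure B)%E.
Proof.
move=> c0 B mB.
pose h := (fun z => c * z + t) : measurableTypeR R -> measurableTypeR R.
have mh : measurable_fun setT h.
  apply: measurable_funD => //; apply: measurable_funM => //.
have nc : 0 <= `|c| by [].
pose mu := measure_function_mscale__canonical__measure_function_Measure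
  (NngNum nc) (pushed_measure (@lebesgue_measure R) mh).
rewrite [RHS](@lebesgue_measure_unique R mu)// => _ [[a b] /= ab <-].
rewrite /mu/= /mscale/= /pushforward.
have cp : 0 < `|c| by rewrite normr_gt0.
have [c_gt0|] := ltP 0 c.
  rewrite (_ : h @^-1` _ = `](a - t) / c, (b - t) / c]%classic); last first.
    apply/seteqP; split => z; rewrite /h /= !in_itv/= (mulrC c).
      by rewrite -ltrBlDr -lerBrDr ltr_pdivrMr// ler_pdivlMr.
    by rewrite -ltrBlDr -lerBrDr ltr_pdivrMr// ler_pdivlMr.
  rewrite !lebesgue_measure_itv/= !lte_fin ltr_pM2r ?invr_gt0// ltrD2r.
  case: ifP => _; last by rewrite mule0.
  by rewrite -!EFinB -EFinM gtr0_norm//; congr _%:E; field.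
rewrite le_eqVlt (negbTE c0)/= => c_lt0.
rewrite (_ : h @^-1` _ = `[(b - t) / c, (a - t) / c[%classic); last first.
  apply/seteqP; split => z; rewrite /h /= !in_itv/= (mulrC c).
    by rewrite -ltrBlDr -lerBrDr ltr_ndivlMr// ler_ndivrMr// andbC.
  by rewrite -ltrBlDr -lerBrDr ltr_ndivlMr// ler_ndivrMr// andbC.
rewrite !lebesgue_measure_itv/= !lte_fin ltr_nM2r ?invr_lt0// ltrD2r.
case: ifP => _; last by rewrite mule0.
by rewrite -!EFinB -EFinM ltr0_norm//; congr _%:E; field.
Qed.

End affine1.

Lemma lup_factorization (F : fieldType) n (A : 'M[F]_n.+1) :
  exists s : 'S_n.+1, exists L U : 'M[F]_n.+1, [/\
    perm_mx s *m A = L *m U,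
    forall i j : 'I_n.+1, (i <= j)%N -> L i j = (i == j)%:R &
    forall i j : 'I_n.+1, (j < i)%N -> U i j = 0].
Proof.
have := cormen_lup_correct A.
have := cormen_lup_perm A; have := @cormen_lup_upper _ _ A; have := @cormen_lup_lower _ _ A.
case: (cormen_lup A) => -[P L] U /= Lo Up /is_perm_mxP[s ->] PA.
by exists s, L, U; split.
Qed.

Section linear.
Variable R : realType.

Lemma measurable_coord (i : 'I_3) :
  measurable_fun setT (fun x : 'rV[R]_3 => x 0 i).
Proof.
apply: (measurability _ (RGenCInfty.measurableE R)) => _ [_ [r ->] <-].
rewrite setTI (_ : _ @^-1` _ = [set x : 'rV[R]_3 | r <= x 0 i]).
  by rewrite measurable_boxes; exact: boxes_coord.
by apply/seteqP; split => x /=; rewrite in_itv/= andbT.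
Qed.

Lemma measurable_row3 d (T : measurableType d) (D : set T) (f : T -> 'rV[R]_3) :
  measurable D -> (forall i, measurable_fun D (fun x => f x 0 i)) ->
  measurable_fun D f.
Proof.
move=> mD mf.
apply: (measurability _ (measurable_boxes R)) => _ [_ [a [b ->]] <-].
rewrite (_ : _ `&` _ = \bigcap_(i : 'I_3)
   (D `&` (fun x => f x 0 i) @^-1` `[a 0 i, b 0 i[%classic)).
  by apply: fin_bigcap_measurable => // i _; exact: mf.
apply/seteqP; split => x /=.
  by move=> [Dx h] i _; split => //=; rewrite in_itv/=; exact: h.
move=> h; split; first by have [] := h 0 Logic.I.
by move=> i; have [_] := h i Logic.I; rewrite /= in_itv.
Qed.

Lemma measurable_mulmx (A : 'M[R]_3) :
  measurable_fun setT (fun x : 'rV[R]_3 => x *m A).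
Proof.
apply: measurable_row3 => // i; under eq_fun do rewrite mxE.
by apply: measurable_sum => j; apply: measurable_funM => //; exact: measurable_coord.
Qed.

Lemma measurable_shift (v : 'rV[R]_3) :
  measurable_fun setT (fun x : 'rV[R]_3 => x + v).
Proof.
apply: measurable_row3 => // i; under eq_fun do rewrite mxE.
by apply: measurable_funD => //; exact: measurable_coord.
Qed.

Lemma ccube_lt n (i : 'I_3) : (const_mx (- n.+1%:R) : 'rV[R]_3) 0 i <
  (const_mx n.+1%:R : 'rV[R]_3) 0 i.
Proof. by rewrite !mxE (@lt_trans _ _ 0)// ?oppr_lt0 ltr0n. Qed.

Lemma vol_ccube n : (vol (@ccube R n) < +oo)%E.
Proof. by rewrite vol_box ?ltry// => i; rewrite ltW// ccube_lt. Qed.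

(** Finiteness on the exhausting cubes, needed for uniqueness, comes for free from
    the hypothesis. *)
Lemma vol_preimage (f : 'rV[R]_3 -> 'rV[R]_3) : measurable_fun setT f ->
  (forall a b : 'rV[R]_3, (forall i, a 0 i < b 0 i) -> vol (f @^-1` box a b) = vol (box a b)) ->
  forall E, measurable E -> vol (f @^-1` E) = vol E.
Proof.
move=> mf fE.
have := @boxes_unique R (pushed_measure (@vol R) mf) (@vol R); apply => // n.
change (vol (f @^-1` ccube n) < +oo)%E.
by rewrite fE; [exact: vol_ccube|exact: ccube_lt].
Qed.

Lemma vol_shift (v : 'rV[R]_3) E : measurable E ->
  vol ((fun x => x + v) @^-1` E) = vol E.
Proof.
move: E; apply: vol_preimage => [|a b ab]; first exact: measurable_shift.
have -> : (fun x => x + v) @^-1` box a b = box (a - v) (b - v).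
  by apply/seteqP; split => x h i; move: (h i); rewrite !mxE lerBlDr ltrBrDr.
rewrite !vol_box => [|i|i]; rewrite ?mxE ?lerD2r ?ltW//.
by congr _%:E; apply: eq_bigr => i _; rewrite !mxE; ring.
Qed.

(** The change of variables formula for the linear map [x |-> x *m A].  It is
    stated with a preimage and a product, so as to avoid dividing extended reals. *)
Definition scales_volume (A : 'M[R]_3) := forall E, measurable E ->
  (`|\det A|%:E * vol ((fun x => (x *m A)%R) @^-1` E) = vol E)%E.

Lemma scales_volumeM A B : scales_volume A -> scales_volume B -> scales_volume (A *m B).
Proof.
move=> sA sB E mE; rewrite det_mulmx normrM mulrC EFinM -muleA.
rewrite (_ : _ @^-1` E = (fun x => x *m A) @^-1` ((fun x => x *m B) @^-1` E)).
  rewrite sA ?sB// -[X in measurable X]setTI; exact: measurable_mulmx.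
by apply/seteqP; split => x /=; rewrite mulmxA.
Qed.

Lemma scales_volume_perm (s : 'S_3) : scales_volume (perm_mx s).
Proof.
move=> E mE; rewrite det_perm normrX normrN1 expr1n mul1e.
move: E mE; apply: vol_preimage => [|a b ab]; first exact: measurable_mulmx.
have -> : (fun x : 'rV[R]_3 => x *m perm_mx s) @^-1` box a b =
    box (\row_j a 0 (s j)) (\row_j b 0 (s j)).
  have xsE (x : 'rV[R]_3) i : (x *m perm_mx s) 0 i = x 0 ((s^-1)%g i).
    by have := col_permE (s^-1)%g x; rewrite invgK => <-; rewrite mxE.
  apply/seteqP; split => x h i.
    by have := h (s i); rewrite xsE permK !mxE.
  by have := h ((s^-1)%g i); rewrite xsE !mxE permKV.
rewrite !vol_box => [|i|i]; rewrite ?mxE ?ltW//.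
congr _%:E; rewrite [RHS](reindex_inj (@perm_inj _ s)).
by apply: eq_bigr => i _; rewrite !mxE.
Qed.

(** The map [x |-> x *m column_replacement j v] changes only the coordinate [j] of x,
    into the value of a linear form. *)
Definition column_replacement (j : 'I_3) (v : 'I_3 -> R) : 'M[R]_3 :=
  \matrix_(i, k) if k == j then v i else (i == k)%:R.

Lemma det_column_replacement2 v : \det (column_replacement 2 v) = v 2.
Proof.
rewrite -det_tr det_trig; last first.
  by apply/is_trig_mxP; apply: ord3P; apply: ord3P; rewrite !mxE.
rewrite !big_ord_recl big_ord0 !mxE /= mul1r mul1r mulr1.
by congr v; exact/val_inj.
Qed.

(** By Fubini: on each vertical line the map is affine with slope [v 2]. *)
Lemma scales_volume_column_replacement2 v : v 2 != 0 -> scales_volume (column_replacement 2 v).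
Proof.
move=> v20 E mE; rewrite det_column_replacement2.
pose phi := (fun x : 'rV[R]_3 => x *m column_replacement 2 v).
have mB : measurable (@pt3 R @^-1` (phi @^-1` E)).
  have : measurable (phi @^-1` E).
    by rewrite -[X in measurable X]setTI; exact: measurable_mulmx.
  by [].
have mE' : measurable (@pt3 R @^-1` E) by [].
transitivity (\int[(@lebesgue_measure R \x @lebesgue_measure R)%E]_p
  (`|v 2|%:E * lebesgue_measure (xsection (@pt3 R @^-1` (phi @^-1` E)) p)))%E.
  rewrite /vol /pushforward /leb3 {1}/product_measure1.
  symmetry; apply: ge0_integralZl => //.
  exact: measurable_fun_xsection.
rewrite /vol /pushforward /leb3 {2}/product_measure1.
apply: eq_integral => -[x y] _ /=.
rewrite -[RHS](@lebesgue_affine _ (v 2) (v 0 * x + v 1 * y)) //; last first.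
  exact: measurable_xsection.
congr (_ * lebesgue_measure _)%E.
have phiE z : phi (pt3 (x, y, z)) = pt3 (x, y, v 2 * z + (v 0 * x + v 1 * y)).
  apply/rowP; apply: ord3P; rewrite /phi /pt3 !mxE !big_ord_recl big_ord0 !mxE/=.
  - by ring.
  - by ring.
  - rewrite (_ : lift ord0 (lift ord0 ord0) = 2); last exact/val_inj.
    rewrite (_ : lift ord0 ord0 = 1); last exact/val_inj.
    by rewrite (_ : ord0 = 0)//; ring.
apply/seteqP; split => z; rewrite /xsection/= !inE/=.
  by rewrite -phiE.
by rewrite -phiE.
Qed.

(** Conjugation by a transposition moves the replaced coordinate to the last place. *)
Lemma scales_volume_column_replacement j v : v j != 0 -> scales_volume (column_replacement j v).
Proof.
move=> vj0; pose t := tperm j 2.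
have -> : column_replacement j v = perm_mx t *m column_replacement 2 (fun i => v (t i)) *m perm_mx t.
  apply/matrixP => i k; rewrite -row_permE -[X in _ *m perm_mx X]invgK -col_permE.
  rewrite !mxE /t tpermV tpermK.
  rewrite (can_eq (tpermK j 2)); congr (if _ then _ else _).
  by rewrite -[RHS](can_eq (tpermK j 2)) tpermK tpermR.
apply: scales_volumeM; last exact: scales_volume_perm.
apply: scales_volumeM; first exact: scales_volume_perm.
by apply: scales_volume_column_replacement2; rewrite tpermR.
Qed.

Lemma sum_ord3 (f : 'I_3 -> R) : \sum_i f i = f 0 + f 1 + f 2.
Proof.
rewrite !big_ord_recr big_ord0/= add0r.
by congr (f _ + f _ + f _); exact/val_inj.
Qed.

(** The coordinates of [x *m A] are computed one after the other, in place; for a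
    lower triangular A the first one can be overwritten first, as it does not
    occur in the next ones. *)
Lemma scales_volume_lower (A : 'M[R]_3) : (forall i j : 'I_3, (i < j)%N -> A i j = 0) ->
  (forall i : 'I_3, A i i != 0) -> scales_volume A.
Proof.
move=> A0 Ad.
have -> : A = column_replacement 0 (fun i => A i 0) *m column_replacement 1 (fun i => A i 1) *m
    column_replacement 2 (fun i => A i 2).
  have A1 : A 0 1 = 0 by rewrite A0.
  have A2 : A 0 2 = 0 by rewrite A0.
  have A3 : A 1 2 = 0 by rewrite A0.
  apply/matrixP; apply: ord3P; apply: ord3P; rewrite !mxE !sum_ord3 !mxE !sum_ord3 !mxE/=
    ?A1 ?A2 ?A3; ring.
have s0 := @scales_volume_column_replacement 0 (fun i => A i 0) (Ad 0).
have s1 := @scales_volume_column_replacement 1 (fun i => A i 1) (Ad 1).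
have s2 := @scales_volume_column_replacement 2 (fun i => A i 2) (Ad 2).
exact: (scales_volumeM (scales_volumeM s0 s1) s2).
Qed.

(** As for a lower triangular matrix, in the opposite order. *)
Lemma scales_volume_upper (A : 'M[R]_3) : (forall i j : 'I_3, (j < i)%N -> A i j = 0) ->
  (forall i : 'I_3, A i i != 0) -> scales_volume A.
Proof.
move=> A0 Ad.
have -> : A = column_replacement 2 (fun i => A i 2) *m column_replacement 1 (fun i => A i 1) *m
    column_replacement 0 (fun i => A i 0).
  have A1 : A 1 0 = 0 by rewrite A0.
  have A2 : A 2 0 = 0 by rewrite A0.
  have A3 : A 2 1 = 0 by rewrite A0.
  apply/matrixP; apply: ord3P; apply: ord3P; rewrite !mxE !sum_ord3 !mxE !sum_ord3 !mxE/=
    ?A1 ?A2 ?A3; ring.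
have s2 := @scales_volume_column_replacement 2 (fun i => A i 2) (Ad 2).
have s1 := @scales_volume_column_replacement 1 (fun i => A i 1) (Ad 1).
have s0 := @scales_volume_column_replacement 0 (fun i => A i 0) (Ad 0).
exact: (scales_volumeM (scales_volumeM s2 s1) s0).
Qed.

Lemma scales_volume_unitmx (A : 'M[R]_3) : A \in unitmx -> scales_volume A.
Proof.
move=> uA; have [s [L [U [PA Lo Up]]]] := lup_factorization A.
have LUu : L *m U \in unitmx.
  by rewrite -PA unitmx_mul unitmx_perm.
have Ud i : U i i != 0.
  move: LUu; rewrite unitmx_mul => /andP[_]; rewrite unitmxE unitfE -det_tr det_trig.
    move=> /prodf_neq0 /(_ i isT); by rewrite mxE.
  by apply/is_trig_mxP => a b ab; rewrite mxE Up.
have -> : A = perm_mx s^-1 *m (L *m U).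
  by rewrite -PA mulmxA -perm_mxM mulVg perm_mx1 mul1mx.
apply: scales_volumeM; first exact: scales_volume_perm.
apply: scales_volumeM.
  apply: scales_volume_lower => [i j ij|i]; rewrite Lo ?eqxx ?oner_eq0//; last exact: ltnW.
  by case: eqP ij => // ->; rewrite ltnn.
exact: scales_volume_upper.
Qed.

Let preimage_measurable (h : 'rV[R]_3 -> 'rV[R]_3) F : measurable_fun setT h ->
  measurable F -> measurable (h @^-1` F).
Proof. by move=> mh mF; rewrite -[X in measurable X]setTI; exact: mh. Qed.

Lemma measurable_affine (A : 'M[R]_3) (x0 y0 : 'rV[R]_3) E : measurable E ->
  measurable ((fun y => (y - y0) *m A + x0) @^-1` E).
Proof.
move=> mE; exact: (preimage_measurable (measurable_shift (- y0))
  (preimage_measurable (measurable_mulmx A) (preimage_measurable (measurable_shift x0) mE))).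
Qed.

(** This is the volume of the image of E by the affine map
    [x |-> (x - x0) *m A + y0], written as a preimage. *)
Lemma vol_affine (A : 'M[R]_3) (x0 y0 : 'rV[R]_3) E : A \in unitmx -> measurable E ->
  vol ((fun y => (y - y0) *m invmx A + x0) @^-1` E) = (`|\det A|%:E * vol E)%E.
Proof.
move=> uA mE.
pose E1 := (fun x => x + x0) @^-1` E.
have mE1 : measurable E1 := preimage_measurable (measurable_shift x0) mE.
have uA' : invmx A \in unitmx by rewrite unitmx_inv.
rewrite (_ : _ @^-1` E = (fun x => x + (- y0)) @^-1` ((fun x => x *m invmx A) @^-1` E1))//.
rewrite vol_shift; last exact: (preimage_measurable (measurable_mulmx _) mE1).
rewrite -(vol_shift x0 mE) -/E1 -(scales_volume_unitmx uA' mE1) muleA -EFinM -normrM.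
by rewrite -det_mulmx mulmxV// det1 normr1 mul1e.
Qed.

End linear.

(** * Bisection of boxes, and open sets as unions of boxes *)

Section bisection.
Variable R : realType.

Implicit Types a b x : 'rV[R]_3.

Definition set_coord b (i : 'I_3) (c : R) : 'rV[R]_3 :=
  \row_j if j == i then c else b 0 j.

Lemma box_cut a b i c : a 0 i <= c <= b 0 i ->
  box a b = box a (set_coord b i c) `|` box (set_coord a i c) b /\
  box a (set_coord b i c) `&` box (set_coord a i c) b = set0.
Proof.
move=> /andP[ac cb]; split; apply/seteqP; split => x //=.
- move=> h; have [xc|cx] := ltP (x 0 i) c; [left|right] => j;
    have := h j; have := h i; rewrite !mxE; case: eqP => [->|_]; lra.
- by case=> h j; have := h j; rewrite !mxE; case: eqP => // ->; move: ac cb; lra.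
- by move=> [/(_ i) + /(_ i)]; rewrite !mxE eqxx; lra.
Qed.

Variable P : 'rV[R]_3 -> 'rV[R]_3 -> Prop.
Hypothesis Psplit : forall a b i c, a 0 i <= c <= b 0 i ->
  P a (set_coord b i c) -> P (set_coord a i c) b -> P a b.

Let half1 (i : 'I_3) a b : (forall j, a 0 j <= b 0 j) -> ~ P a b ->
  exists a' b', [/\ ~ P a' b',
    forall j, a 0 j <= a' 0 j /\ b' 0 j <= b 0 j &
    forall j, b' 0 j - a' 0 j = if j == i then (b 0 j - a 0 j) / 2 else b 0 j - a 0 j].
Proof.
move=> ab nP; pose c := (a 0 i + b 0 i) / 2.
have ac : a 0 i <= c <= b 0 i by have := ab i; rewrite /c; lra.
have [P1|nP1] := pselect (P a (set_coord b i c)); last first.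
  exists a, (set_coord b i c); split => // j; rewrite !mxE;
    case: eqP => [->|_] //; first (by split; lra); rewrite /c; lra.
have [P2|nP2] := pselect (P (set_coord a i c) b); last first.
  exists (set_coord a i c), b; split => // j; rewrite !mxE;
    case: eqP => [->|_] //; first (by split; lra); rewrite /c; lra.
by exfalso; apply/nP/(Psplit ac).
Qed.

Let half3 a b : (forall j, a 0 j <= b 0 j) -> ~ P a b ->
  exists a' b', [/\ ~ P a' b',
    forall j, a 0 j <= a' 0 j /\ b' 0 j <= b 0 j &
    forall j, b' 0 j - a' 0 j = (b 0 j - a 0 j) / 2].
Proof.
move=> ab /(half1 0 ab)[a1 [b1 [nP1 s1 h1]]].
have ab1 j : a1 0 j <= b1 0 j by have := h1 j; have := ab j; case: ifP => _; lra.
move: nP1 => /(half1 1 ab1)[a2 [b2 [nP2 s2 h2]]].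
have ab2 j : a2 0 j <= b2 0 j by have := h2 j; have := ab1 j; case: ifP => _; lra.
move: nP2 => /(half1 2 ab2)[a3 [b3 [nP3 s3 h3]]].
exists a3, b3; split => // j.
  have [? ?] := s1 j; have [? ?] := s2 j; have [? ?] := s3 j; lra.
move: (h1 j) (h2 j) (h3 j); move: j.
by apply: ord3P => /= -> -> ->.
Qed.

(** Cousin's principle.  If P failed on a box, it would fail on a nested sequence of
    boxes, each obtained from the previous one by halving all three sides; these
    shrink to a point, near which P is known to hold.  The small boxes keep the
    proportions of the initial box, which matters for estimates relative to volume. *)
Lemma bisection a b : (forall i, a 0 i <= b 0 i) ->
  (forall x, (forall i, a 0 i <= x 0 i <= b 0 i) ->
    exists n0, forall n a' b', (n0 <= n)%N ->
      (forall i, [/\ a 0 i <= a' 0 i, a' 0 i <= x 0 i, x 0 i <= b' 0 i,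
        b' 0 i <= b 0 i & b' 0 i - a' 0 i = (b 0 i - a 0 i) / 2 ^+ n]) -> P a' b') ->
  P a b.
Proof.
move=> ab loc; apply: contrapT => nP.
pose S := {p : 'rV[R]_3 * 'rV[R]_3 | ~ P p.1 p.2 /\ forall j, p.1 0 j <= p.2 0 j}.
have step (p : S) : {q : S | forall j, [/\ (sval p).1 0 j <= (sval q).1 0 j,
    (sval q).2 0 j <= (sval p).2 0 j &
    (sval q).2 0 j - (sval q).1 0 j = ((sval p).2 0 j - (sval p).1 0 j) / 2]}.
  apply: cid; case: p => -[c d] [/= nPcd cd].
  have [c' [d' [nP' s h]]] := half3 cd nPcd.
  have cd' j : c' 0 j <= d' 0 j by have := h j; have := cd j; lra.
  by exists (exist _ (c', d') (conj nP' cd')) => j /=; have [? ?] := s j.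
pose s0 : S := exist _ (a, b) (conj nP ab).
pose s n : S := iter n (fun p => sval (step p)) s0.
pose A n := (sval (s n)).1; pose B n := (sval (s n)).2.
have AB n j : A n 0 j <= B n 0 j by exact: (svalP (s n)).2.
have st n j : [/\ A n 0 j <= A n.+1 0 j, B n.+1 0 j <= B n 0 j &
    B n.+1 0 j - A n.+1 0 j = (B n 0 j - A n 0 j) / 2] by exact: (svalP (step (s n))).
have Amono n k j : A n 0 j <= A (n + k)%N 0 j.
  elim: k => [|k /le_trans IH]; rewrite ?addn0//; apply: IH.
  by rewrite addnS; have [] := st (n + k)%N j.
have Bmono n k j : B (n + k)%N 0 j <= B n 0 j.
  elim: k => [|k IH]; rewrite ?addn0//; apply: le_trans IH.
  by rewrite addnS; have [] := st (n + k)%N j.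
have Al n m j : A n 0 j <= B m 0 j.
  apply: le_trans (Amono n m j) _; apply: le_trans (AB _ _) _.
  by rewrite addnC Bmono.
have width n j : B n 0 j - A n 0 j = (b 0 j - a 0 j) / 2 ^+ n.
  elim: n => [|n IH]; first by rewrite expr0 divr1.
  by have [_ _ ->] := st n j; rewrite IH exprS; field.
pose x : 'rV[R]_3 := \row_j sup (range (fun n => A n 0 j)).
have Ax n j : A n 0 j <= x 0 j.
  rewrite mxE; apply: ub_le_sup; last by exists n.
  by exists (B 0%N 0 j) => _ [m _ <-]; exact: Al.
have xB n j : x 0 j <= B n 0 j.
  rewrite mxE; apply: ge_sup; first by exists (A 0%N 0 j), 0%N.
  by move=> _ [m _ <-]; exact: Al.
have [|n0 loc'] := loc x.
  by move=> i; rewrite (Ax 0%N i) (xB 0%N i).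
apply: (svalP (s n0)).1; apply: (loc' n0) => // i.
have := Amono 0%N n0 i; have := Bmono 0%N n0 i; rewrite !add0n => h1 h2.
split => //; [exact: Ax|exact: xB|exact: width].
Qed.

End bisection.

Section open_boxes.
Variable R : realType.

Implicit Types a b x : 'rV[R]_3.

(** Boxes with rational centre and radius [1 / n.+1] whose closure lies in O.  Empty
    sets pad the enumeration. *)
Lemma open_boxes (O : set 'rV[R]_3) : open O ->
  exists D : (set 'rV[R]_3)^nat, O = \bigcup_n D n /\
   forall n, D n = set0 \/ exists a b, [/\ forall i, a 0 i < b 0 i, D n = box a b &
     [set x : 'rV[R]_3 | forall i, a 0 i <= x 0 i <= b 0 i] `<=` O].
Proof.
move=> oO.
pose lo (j : 'rV[rat]_3 * nat) : 'rV[R]_3 := \row_i (ratr (j.1 0 i) - j.2.+1%:R^-1).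
pose hi (j : 'rV[rat]_3 * nat) : 'rV[R]_3 := \row_i (ratr (j.1 0 i) + j.2.+1%:R^-1).
pose good j := [set x : 'rV[R]_3 | forall i, lo j 0 i <= x 0 i <= hi j 0 i] `<=` O.
exists (fun n => if unpickle n is Some j then
   if `[< good j >] then box (lo j) (hi j) else set0 else set0).
split; last first.
  move=> n; case: unpickle => [j|]; last by left.
  case: asboolP => [gj|_]; last by left.
  right; exists (lo j), (hi j); split => // i; rewrite !mxE.
  by rewrite ltrBlDr -addrA ltrDl addr_gt0.
apply/seteqP; split => [x Ox|x [n _]]; last first.
  case: unpickle => [j|]//; case: asboolP => //.
  by move=> gj /= xj; apply: gj => i; have /andP[-> /ltW ->] := xj i.
have /nbhs_ballP[e /= e0 xeO] : nbhs x O by exact: open_nbhs_nbhs.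
have [k] : exists k, 0 + k.+1%:R^-1 < e / 2 by apply: ltr_add_invr; rewrite divr_gt0.
rewrite add0r => ke.
have kp : 0 < k.+1%:R^-1 :> R by rewrite invr_gt0.
have [q hq] : exists q : 'I_3 -> rat, forall i, x 0 i - k.+1%:R^-1 < ratr (q i) < x 0 i + k.+1%:R^-1.
  have /choice[q hq] : forall i : 'I_3, exists q : rat,
      x 0 i - k.+1%:R^-1 < ratr q < x 0 i + k.+1%:R^-1.
    move=> i; have [|q] := @rat_in_itvoo _ (x 0 i - k.+1%:R^-1) (x 0 i + k.+1%:R^-1).
      by rewrite ltrBlDr -addrA ltrDl addr_gt0.
    by rewrite in_itv/=; exists q.
  by exists q.
pose j : 'rV[rat]_3 * nat := (\row_i q i, k).
exists (pickle j) => //; rewrite pickleK.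
have loE i : lo j 0 i = ratr (q i) - k.+1%:R^-1 by rewrite !mxE.
have hiE i : hi j 0 i = ratr (q i) + k.+1%:R^-1 by rewrite !mxE.
case: asboolP => [_ i|].
  rewrite loE hiE; have := hq i; move: kp.
  by move: (ratr (q i)) (k.+1%:R^-1 : R) => Q r ? ?; lra.
case=> y hy; apply: xeO; split => // i0 i; rewrite ord1 -ball_normE/= ltr_norml.
move: (hy i) (hq i); rewrite loE hiE; move: kp ke.
by move: (ratr (q i)) (k.+1%:R^-1 : R) => Q r ? ? ? ?; lra.
Qed.

Lemma open_measurable3 (O : set 'rV[R]_3) : open O -> measurable O.
Proof.
move=> /open_boxes[D [-> hD]]; apply: bigcupT_measurable => n.
by have [->|[a [b [_ -> _]]]] := hD n; [exact: measurable0|exact: measurable_box].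
Qed.

Lemma open_preimage (T S : topologicalType) (f : T -> S) (U : set T) (V : set S) :
  open U -> open V -> (forall t, U t -> {for t, continuous f}) -> open (U `&` f @^-1` V).
Proof.
move=> oU oV cf; rewrite openE => x [Ux Vfx]; rewrite /interior.
apply: filterI; first exact: open_nbhs_nbhs.
by apply: (cf x Ux); exact: open_nbhs_nbhs.
Qed.

Lemma continuous_measurable_on (U : set 'rV[R]_3) (f : 'rV[R]_3 -> R) : open U ->
  (forall x, U x -> {for x, continuous f}) -> measurable_fun U f.
Proof.
move=> oU cf; apply: (measurability _ (RGenOpens.measurableE R)).
move=> _ [_ [a [b ->]] <-]; apply: open_measurable3.
by apply: open_preimage.
Qed.

Lemma continuous_measurable_row (U : set 'rV[R]_3) (f : 'rV[R]_3 -> 'rV[R]_3) : open U ->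
  (forall x, U x -> {for x, continuous f}) -> measurable_fun U f.
Proof.
move=> oU cf; apply: measurable_row3; first exact: open_measurable3.
move=> i; apply: continuous_measurable_on => // x Ux.
apply: (@continuous_comp _ _ _ f (fun M : 'rV[R]_3 => M 0 i)); first exact: cf.
exact: coord_continuous.
Qed.

End open_boxes.

(** * Measures with a density, and first-order expansions *)

Section density.
Context d (T : measurableType d) (R : realType) (mu : {measure set T -> \bar R}).
Variable w : T -> R.
Hypotheses (mw : measurable_fun setT w) (w0 : forall x, 0 <= w x).
Local Open Scope ereal_scope.

(** The two proofs are arguments only to let the measure structure be inferred. *)
Definition density (_ : measurable_fun setT w) (_ : forall x, (0 <= w x)%R) :
  set T -> \bar R := fun A => \int[mu]_(x in A) (w x)%:E.

Let density0 : density mw w0 set0 = 0.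
Proof. exact: integral_set0. Qed.

Let density_ge0 A : 0 <= density mw w0 A.
Proof. by apply: integral_ge0 => x _; rewrite lee_fin. Qed.

Let density_sigma_additive : semi_sigma_additive (density mw w0).
Proof.
apply: semi_sigma_additive_nng_induced; first exact/measurable_EFinP.
by move=> x; rewrite lee_fin.
Qed.

HB.instance Definition _ := isMeasure.Build _ _ _ (density mw w0)
  density0 density_ge0 density_sigma_additive.

Import HBNNSimple.

(** Both sides agree on simple functions, and pass to monotone limits. *)
Lemma integral_density (f : T -> \bar R) (E : set T) : (forall x, E x -> 0 <= f x) ->
    measurable E -> measurable_fun E f ->
  \int[density mw w0]_(x in E) f x = \int[mu]_(x in E) (f x * (w x)%:E).
Proof.
move=> f0 mE mf; symmetry; set g := EFin \o w.
have mg : measurable_fun setT g by exact/measurable_EFinP.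
have g0 x : 0 <= g x by rewrite lee_fin.
set nu := density mw w0.
pose h := nnsfun_approx mE mf.
have -> : \int[nu]_(x in E) f x =
    lim (\int[nu]_(x in E) (EFin \o h n) x @[n --> \oo]).
  have fE x : E x -> f x = lim ((EFin \o h n) x @[n --> \oo]).
    by move=> Ex; apply/esym/cvg_lim => //; exact: cvg_nnsfun_approx.
  under eq_integral => x /[!inE] /fE -> //.
  apply: monotone_convergence => //.
  - move=> n; apply/measurable_EFinP.
    by apply: (measurable_funS measurableT) => //; exact/measurable_funP.
  - by move=> n x Ex //=; rewrite lee_fin.
  - by move=> x Ex a b ab; rewrite lee_fin; exact/lefP/nd_nnsfun_approx.
have -> : \int[mu]_(x in E) (f x * (w x)%:E) =
    lim (\int[mu]_(x in E) ((EFin \o h n) \* g) x @[n --> \oo]).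
  have fg x : E x -> f x * (w x)%:E = lim (((EFin \o h n) \* g) x @[n --> \oo]).
    by move=> Ex; apply/esym/cvg_lim => //; apply: cvgeZr => //;
      exact: cvg_nnsfun_approx.
  under eq_integral => x /[!inE] /fg -> //.
  apply: monotone_convergence => [//| | |].
  - move=> n; apply/emeasurable_funM; apply/measurable_funTS => //.
    exact/measurable_EFinP.
  - by move=> n x Ex /=; rewrite mule_ge0 ?lee_fin.
  - by move=> x Ex a b ab/=; rewrite lee_wpmul2r ?lee_fin//; exact/lefP/nd_nnsfun_approx.
suff suf n : \int[mu]_(x in E) ((EFin \o h n) x * g x) =
    \int[nu]_(x in E) (EFin \o h n) x.
  by under eq_fun do rewrite suf.
transitivity (\int[nu]_(x in E)
   (\sum_(y \in range (h n)) (y * \1_(h n @^-1` [set y]) x)%:E)); last first.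
  by apply: eq_integral => t tE; rewrite /= fimfunE -fsumEFin.
have indich m r : measurable_fun E (fun x => (r * \1_(h m @^-1` [set r]) x)%:E).
  by apply: (measurable_comp measurableT) => //; exact: measurable_funM.
rewrite ge0_integral_fsum//; last by move=> m y Ey; exact: nnfun_muleindic_ge0.
transitivity (\int[mu]_(x in E) (\sum_(y \in range (h n))
    (y * \1_(h n @^-1` [set y]) x)%:E * g x)).
  under [RHS]eq_integral => x xE.
    rewrite -ge0_mule_fsuml => [|y]; last exact: nnfun_muleindic_ge0.
    rewrite fsumEFin // -(fimfunE _ x); over.
  by [].
rewrite ge0_integral_fsum//; last 2 first.
  - by move=> y; apply: emeasurable_funM => //; apply: measurable_funTS.
  - by move=> m y Ey; rewrite mule_ge0// nnfun_muleindic_ge0.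
apply: eq_fsbigr => r rhn.
under [RHS]eq_integral do rewrite EFinM.
rewrite integralZl_indic_nnsfun => //.
under eq_integral do rewrite EFinM -muleA.
rewrite ge0_integralZl//.
- under eq_integral do rewrite muleC.
  rewrite (eq_integral (g \_ (h n @^-1` [set r]))); last first.
    by move=> x xE; rewrite epatch_indic.
  by rewrite -integral_mkcondr integral_indic// setIC.
- apply: emeasurable_funM; first exact/measurable_EFinP.
  exact/measurable_funTS.
- by move=> x Ex; rewrite mule_ge0 ?lee_fin.
- by move: rhn; rewrite inE => -[x _ <-]; rewrite lee_fin.
Qed.

End density.

Section differential_estimates.
Variable R : realType.

Implicit Types x y z v : 'rV[R]_3.

Lemma coord_le_norm v i : `|v 0 i| <= `|v|.
Proof.
rewrite [leRHS]mx_normrE (bigD1 (0, i))//=.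
by rewrite le_max lexx.
Qed.

Lemma norm_le_coord v (c : R) : 0 <= c -> (forall i, `|v 0 i| <= c) -> `|v| <= c.
Proof.
move=> c0 h; rewrite [leLHS]mx_normrE; apply: bigmax_le => // -[i j] _ /=.
by rewrite (ord1 i).
Qed.

Lemma mulmx_bound (A : 'M[R]_3) : exists2 K : R, 0 < K & forall v, `|v *m A| <= K * `|v|.
Proof.
exists (1 + \sum_i \sum_j `|A i j|).
  by rewrite ltr_pwDl// sumr_ge0// => i _; rewrite sumr_ge0.
move=> v; apply: norm_le_coord => [|j].
  by rewrite mulr_ge0// addr_ge0// sumr_ge0// => i _; rewrite sumr_ge0.
rewrite mxE; apply: le_trans (ler_norm_sum _ _ _) _.
rewrite mulrDl mul1r mulr_suml; apply: ler_wpDl => //.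
apply: ler_sum => i _; rewrite normrM mulrC mulr_suml (bigD1 j)//=.
apply: ler_wpDr; first by rewrite sumr_ge0// => k _; rewrite mulr_ge0.
by apply: ler_wpM2l => //; exact: coord_le_norm.
Qed.

(** In coordinates, ['J f x] is the transpose of the Jacobian matrix, hence the
    product on the right. *)
Lemma jacobian_expansion (f : 'rV[R]_3 -> 'rV[R]_3) x (e : R) : 0 < e ->
  differentiable f x ->
  exists2 r : R, 0 < r & forall z, `|z - x| < r ->
    `|f z - f x - (z - x) *m 'J f x| <= e * `|z - x|.
Proof.
move=> e0 /diff_locally/eqaddoP/(_ e e0) /nbhs_ballP[r /= r0 h].
exists r => // z zx.
have := h (z - x); rewrite /= -ball_normE/= sub0r normrN => /(_ zx).
congr (`|_| <= _); rewrite /jacobian mul_rV_lin1.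
by rewrite -[LHS]/(f (z - x + x) - (f x + 'd f x (z - x))) subrK opprD addrA.
Qed.

Lemma jacobian_inv (f g : 'rV[R]_3 -> 'rV[R]_3) x :
  differentiable f x -> differentiable g (f x) ->
  (\forall z \near x, g (f z) = z) -> 'J f x *m 'J g (f x) = 1%:M.
Proof.
move=> df dg gf.
have gfd v : 'D_v (g \o f) x = v.
  rewrite (@near_eq_derive _ _ _ (g \o f) id)//.
  by rewrite derive_id.
have dfg : differentiable (g \o f) x by exact: differentiable_comp.
apply/row_matrixP => i; rewrite !rowE mulmxA mulmx1 /jacobian !mul_rV_lin1.
by rewrite -[RHS]gfd [RHS]deriveE// [in RHS]diff_comp.
Qed.

Lemma continuous_sum_at (T : topologicalType) (I : Type) (r : seq I)
    (F : I -> T -> R) (t : T) : (forall i, {for t, continuous (F i)}) ->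
  {for t, continuous (fun q : T => \sum_(i <- r) F i q)}.
Proof.
move=> cF; elim: r => [|i r IH].
  have -> : (fun q : T => \sum_(i <- [::]) F i q) = cst 0 by apply/funext => q; rewrite big_nil.
  exact: cst_continuous.
have -> : (fun q : T => \sum_(j <- i :: r) F j q) = F i \+ (fun q : T => \sum_(j <- r) F j q).
  by apply/funext => q; rewrite big_cons.
exact: continuousD.
Qed.

Lemma continuous_prod_at (T : topologicalType) (I : Type) (r : seq I)
    (F : I -> T -> R) (t : T) : (forall i, {for t, continuous (F i)}) ->
  {for t, continuous (fun q : T => \prod_(i <- r) F i q)}.
Proof.
move=> cF; elim: r => [|i r IH].
  have -> : (fun q : T => \prod_(i <- [::]) F i q) = cst 1 by apply/funext => q; rewrite big_nil.
  exact: cst_continuous.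
have -> : (fun q : T => \prod_(j <- i :: r) F j q) = F i \* (fun q : T => \prod_(j <- r) F j q).
  by apply/funext => q; rewrite big_cons.
exact: continuousM.
Qed.

Lemma det_continuous (f : 'rV[R]_3 -> 'M[R]_3) x :
  {for x, continuous f} -> {for x, continuous (fun y => \det (f y))}.
Proof.
move=> cf; rewrite /determinant; apply: continuous_sum_at => s.
apply: continuousM; first exact: cst_continuous.
apply: continuous_prod_at => i.
apply: (@continuous_comp _ _ _ f (fun M : 'M[R]_3 => M i (s i))) => //.
exact: coord_continuous.
Qed.

End differential_estimates.

(** * Volume of the image of a small box *)

Section local_estimate.
Variable R : realType.

Implicit Types a b x y z : 'rV[R]_3.

Let box_vol a b := \prod_i (b 0 i - a 0 i).

(** The norm on row vectors is the maximum norm, so that two points of a box are at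
    distance at most its longest side. *)
Lemma closed_box_norm a b x z (s : R) :
  (forall i, a 0 i <= x 0 i <= b 0 i) -> (forall i, a 0 i <= z 0 i <= b 0 i) ->
  (forall i, b 0 i - a 0 i <= s) -> `|z - x| <= s.
Proof.
move=> hx hz hs; apply: norm_le_coord => [|i].
  by have := hs 0; have := hx 0; lra.
by rewrite !mxE ler_norml; have := hx i; have := hz i; have := hs i; lra.
Qed.

(** Moving the faces of a box by h, where h is at most t/2 times each side, changes
    its volume by a factor between [(1 - t) ^+ 3] and [(1 + t) ^+ 3], hence between
    [1 - 3 t] and [1 + 7 t]. *)
Lemma volume_perturbation a b (D e t h : R) : 0 <= D -> 0 <= t <= 1/2 ->
  7 * D * t <= e / 2 -> 0 <= h -> (forall i, 2 * h <= t * (b 0 i - a 0 i)) ->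
  (forall i, a 0 i <= b 0 i) ->
  (((D - e / 2) * box_vol a b)%R%:E <=
    D%:E * vol (box (a + const_mx h)%R (b - const_mx h)%R))%E /\
  (D%:E * vol (box (a - const_mx h)%R (b + const_mx h)%R) <=
    ((D + e / 2) * box_vol a b)%R%:E)%E.
Proof.
move=> D0 /andP[t0 t1] te es0 hes ab.
have prodE (c : R) : \prod_(i < 3) ((b 0 i - a 0 i) * c) = box_vol a b * c ^+ 3.
  by rewrite big_split/= prodr_const card_ord.
have V0 : 0 <= box_vol a b by apply: prodr_ge0 => i _; rewrite subr_ge0.
split.
- rewrite vol_box; last first.
    by move=> i; rewrite !mxE; have := hes i; have := ab i; nra.
  rewrite -EFinM lee_fin.
  apply: (@le_trans _ _ (D * (box_vol a b * (1 - t) ^+ 3))).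
    rewrite mulrCA [leRHS]mulrC; apply: ler_wpM2r => //.
    have : D * (1 - 3 * t) <= D * (1 - t) ^+ 3.
      apply: ler_wpM2l => //; nra.
    by apply: le_trans; nra.
  apply: ler_wpM2l => //; rewrite -prodE; apply: ler_prod => i _; rewrite !mxE.
  by have := hes i; have := ab i; nra.
- rewrite vol_box; last first.
    by move=> i; rewrite !mxE; have := hes i; have := ab i; nra.
  rewrite -EFinM lee_fin.
  apply: (@le_trans _ _ (D * (box_vol a b * (1 + t) ^+ 3))); last first.
    rewrite mulrCA [leLHS]mulrC; apply: ler_wpM2r => //.
    have : D * (1 + t) ^+ 3 <= D * (1 + 7 * t).
      apply: ler_wpM2l => //; nra.
    by move=> /le_trans; apply; nra.
  apply: ler_wpM2l => //; rewrite -prodE; apply: ler_prod => i _; rewrite !mxE.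
  by have := hes i; have := ab i; nra.
Qed.

Lemma small_factor (D e : R) : 0 <= D -> 0 < e ->
  exists2 t : R, 0 < t & t <= 1/2 /\ 7 * D * t <= e / 2.
Proof.
move=> D0 e0; have D1 : 0 < 14 * (D + 1) by lra.
exists (Num.min (1/2) (e / (14 * (D + 1)))); first by rewrite lt_min !divr_gt0.
split; first by rewrite ge_min lexx.
apply: (@le_trans _ _ (7 * D * (e / (14 * (D + 1))))).
  by apply: ler_wpM2l; [lra|rewrite ge_min lexx orbT].
rewrite mulrA ler_pdivrMr//; nra.
Qed.

Variables (U V : set 'rV[R]_3) (f g : 'rV[R]_3 -> 'rV[R]_3).
Hypotheses (oU : open U) (oV : open V).
Hypotheses (fUV : forall x, U x -> V (f x)) (gVU : forall y, V y -> U (g y)).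
Hypotheses (fK : forall x, U x -> g (f x) = x) (gK : forall y, V y -> f (g y) = y).
Hypotheses (df : forall x, U x -> differentiable f x)
           (dg : forall y, V y -> differentiable g y).

Lemma jacobian_mulV x : U x -> 'J f x *m 'J g (f x) = 1%:M.
Proof.
move=> Ux; apply: jacobian_inv; [exact: df|exact/dg/fUV|].
by apply: filterS fK _; exact: open_nbhs_nbhs.
Qed.

Lemma measurable_diffeo_image E : measurable E -> measurable (V `&` g @^-1` E).
Proof.
move=> mE; have := @continuous_measurable_row R V g oV; apply => //.
  by move=> y Vy; apply: differentiable_continuous; exact: dg.
exact: open_measurable3.
Qed.

(** The number kap bounds the eccentricity of the boxes.  Let [y] run over the image
    of the box [a, b].  Since f is differentiable at x, the point
    [(y - f x) *m A^-1 + x] differs from [g y] by a small multiple of the size of the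
    box, hence lies in an enlarged box; this bounds the volume of the image from
    above.  The differentiability of g at [f x] shows in the same way that the affine
    image of a shrunk box is covered. *)
Lemma local_image_volume_aux x (A B : 'M[R]_3) (kap e : R) : U x -> 0 < kap -> 0 < e ->
  A *m B = 1%:M ->
  (forall e, 0 < e -> exists2 r : R, 0 < r & forall z, `|z - x| < r ->
    `|f z - f x - (z - x) *m A| <= e * `|z - x|) ->
  (forall e, 0 < e -> exists2 r : R, 0 < r & forall z, `|z - f x| < r ->
    `|g z - g (f x) - (z - f x) *m B| <= e * `|z - f x|) ->
  exists2 r : R, 0 < r & forall a b (s : R), 0 < s < r ->
    (forall i, a 0 i <= x 0 i <= b 0 i) ->
    (forall i, kap * s <= b 0 i - a 0 i <= s) ->
    (((`|\det A| - e / 2) * box_vol a b)%R%:E <=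
       vol (V `&` g @^-1` box a b))%E /\
    (vol (V `&` g @^-1` box a b) <=
      ((`|\det A| + e / 2) * box_vol a b)%R%:E)%E.
Proof.
move=> Ux k0 e0 AB hf0 hg0; pose D := `|\det A|.
have [uA _] := mulmx1_unit AB.
have BE : B = invmx A by rewrite -[B]mul1mx -(mulVmx uA) -mulmxA AB mulmx1.
have [KA KA0 hA] := mulmx_bound A; have [KB KB0 hB] := mulmx_bound B.
have [t t0 [t1 te]] := @small_factor D e (normr_ge0 _) e0.
(* faces move by eta * s, at most t / 2 times each side, as sides are at least kap * s *)
pose eta := kap * t / 2; have eta0 : 0 < eta by rewrite /eta divr_gt0// mulr_gt0.
have [r1 r10 hf] := hf0 _ (divr_gt0 eta0 KB0).
have [r2 r20 hg] := hg0 _ (divr_gt0 eta0 KA0).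
have [r3 /= r30 hV] : exists2 r3 : R, 0 < r3 & forall y, `|y - f x| < r3 -> V y.
  have /nbhs_ballP[r3 /= r30 hV] : nbhs (f x) V by apply: open_nbhs_nbhs; split => //; exact: fUV.
  by exists r3 => // y hy; apply: hV; rewrite -ball_normE/= distrC.
exists (Num.min r1 (Num.min (r2 / KA) (r3 / KA))).
  by rewrite !lt_min r10 !divr_gt0.
move=> a b s /andP[s0]; rewrite !lt_min => /and3P[sr1 sr2 sr3] hx hs.
have hs1 i : b 0 i - a 0 i <= s by have /andP[] := hs i.
have ab i : a 0 i <= b 0 i by have := hx i; lra.
have es0 : 0 <= eta * s by rewrite mulr_ge0 ?ltW.
have hes i : 2 * (eta * s) <= t * (b 0 i - a 0 i).
  have /andP[h _] := hs i; rewrite /eta (_ : 2 * _ = t * (kap * s)); last by field.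
  by apply: ler_wpM2l => //; exact: ltW.
have tt : 0 <= t <= 1/2 by rewrite t1 andbT ltW.
have [lo up] := @volume_perturbation a b D e t (eta * s) (normr_ge0 _) tt te es0 hes ab.
have KAs y : `|y| <= s -> `|y *m A| <= KA * s.
  by move=> ys; apply: le_trans (hA _) _; apply: ler_wpM2l => //; exact: ltW.
rewrite /D -(vol_affine x (f x) uA (measurable_box _ _)) in lo.
rewrite /D -(vol_affine x (f x) uA (measurable_box _ _)) in up.
have mimg : measurable (V `&` g @^-1` box a b).
  by apply: measurable_diffeo_image; exact: measurable_box.
split.
- apply: le_trans lo _; apply: le_measure; rewrite ?inE//; first exact: (measurable_affine _ _ _ (measurable_box _ _)).
  move=> y /= hy; rewrite -BE in hy.
  pose z := (y - f x) *m B + x.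
  have zab i : a 0 i <= z 0 i <= b 0 i.
    by have := hy i; rewrite -/z !mxE; move: es0; lra.
  have zx : `|z - x| <= s by exact: closed_box_norm hs1.
  have yE : y - f x = (z - x) *m A.
    by rewrite /z addrK -mulmxA BE mulVmx// mulmx1.
  have yr : `|y - f x| <= KA * s by rewrite yE; exact: KAs.
  have Vy : V y by apply: hV; apply: le_lt_trans yr _; rewrite mulrC -ltr_pdivlMr.
  split => //= i.
  have gz : `|g y - z| <= eta * s.
    have := hg y; rewrite fK// => /(_ _)/le_trans; rewrite (_ : _ - _ - _ = g y - z).
      apply; first by apply: le_lt_trans yr _; rewrite mulrC -ltr_pdivlMr.
      apply: le_trans (ler_wpM2l (ltW (divr_gt0 eta0 KA0)) yr) _.
      by rewrite mulrA divfK ?gt_eqF.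
    by rewrite /z opprD addrAC addrA.
  have := le_trans (coord_le_norm _ i) gz; rewrite mxE [X in _ + X]mxE ler_norml.
  by have := hy i; rewrite -/z !mxE; lra.
- apply: le_trans up; apply: le_measure; rewrite ?inE//; first exact: (measurable_affine _ _ _ (measurable_box _ _)).
  move=> y [Vy gy] /= i.
  have zx : `|g y - x| <= s.
    by apply: closed_box_norm hx _ hs1 => j; have /andP[-> /ltW ->] := gy j.
  have := hf (g y); rewrite gK// => /(_ (le_lt_trans zx sr1)).
  set E := (X in `|X| <= _) => hE.
  have EB : `|E *m B| <= eta * s.
    apply: le_trans (hB _) _; apply: le_trans (ler_wpM2l (ltW KB0) hE) _.
    rewrite mulrA mulrCA divff ?gt_eqF// mulr1; apply: ler_wpM2l => //; exact: ltW.
  have zE : (y - f x) *m invmx A + x = g y + E *m B.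
    rewrite /E [X in _ = _ + X]mulmxBl -mulmxA AB mulmx1 BE; apply/rowP => k; rewrite !mxE; ring.
  rewrite zE; have := le_trans (coord_le_norm _ i) EB; rewrite ler_norml.
  by have := gy i; rewrite !mxE; lra.
Qed.

Lemma local_image_volume x (kap e : R) : U x -> 0 < kap -> 0 < e ->
  exists2 r : R, 0 < r & forall a b (s : R), 0 < s < r ->
    (forall i, a 0 i <= x 0 i <= b 0 i) ->
    (forall i, kap * s <= b 0 i - a 0 i <= s) ->
    (((`|\det ('J f x : 'M[R]_3)| - e / 2) * box_vol a b)%R%:E <=
       vol (V `&` g @^-1` box a b))%E /\
    (vol (V `&` g @^-1` box a b) <=
      ((`|\det ('J f x : 'M[R]_3)| + e / 2) * box_vol a b)%R%:E)%E.
Proof.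
move=> Ux k0 e0; apply: (local_image_volume_aux Ux k0 e0 (jacobian_mulV Ux)).
  by move=> e' e'0; apply: jacobian_expansion => //; exact: df.
by move=> e' e'0; apply: jacobian_expansion => //; exact/dg/fUV.
Qed.

End local_estimate.

(** * Change of variables for measures *)

(** The pieces [D n] may overlap; they are first made disjoint. *)
Lemma measure_eq_bigcup d (T : measurableType d) (R : realType)
    (m1 m2 : {measure set T -> \bar R}) (D : (set T)^nat) :
  (forall n, measurable (D n)) ->
  (forall n E, measurable E -> m1 (E `&` D n) = m2 (E `&` D n)) ->
  forall E, measurable E -> m1 (E `&` \bigcup_n D n) = m2 (E `&` \bigcup_n D n).
Proof.
move=> mD m12 E mE; rewrite seqDU_bigcup_eq setI_bigcupr.
have mS n : measurable (E `&` seqDU D n).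
  by apply: measurableI => //; exact: seqDU_measurable.
have tS : trivIset setT (fun n => E `&` seqDU D n).
  by apply: trivIset_setIl; exact: trivIset_seqDU.
rewrite !measure_bigcup//; apply: eq_eseriesr => n _.
rewrite (_ : E `&` seqDU D n = (E `&` seqDU D n) `&` D n); first exact: m12.
by rewrite [RHS]setIidl// => x [_]; exact: subset_seqDU.
Qed.

Lemma measure_box_cut (R : realType) (m : {measure set 'rV[R]_3 -> \bar R})
    (a b : 'rV[R]_3) i c : a 0 i <= c <= b 0 i ->
  m (box a b) = (m (box a (set_coord b i c)) + m (box (set_coord a i c) b))%E.
Proof.
move=> acb; have [-> disj] := box_cut acb.
by rewrite measureU//; exact: measurable_box.
Qed.

Section image_measure_jacobian.
Variable R : realType.

Variables (U V : set 'rV[R]_3) (f g : 'rV[R]_3 -> 'rV[R]_3).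
Hypotheses (oU : open U) (oV : open V).
Hypotheses (fUV : forall x, U x -> V (f x)) (gVU : forall y, V y -> U (g y)).
Hypotheses (fK : forall x, U x -> g (f x) = x) (gK : forall y, V y -> f (g y) = y).
Hypotheses (df : forall x, U x -> differentiable f x)
           (dg : forall y, V y -> differentiable g y).
Implicit Types a b : 'rV[R]_3.
Hypothesis (Jc : forall x, U x -> {for x, continuous (fun y => 'J f y)}).

Let mU : measurable U. Proof. exact: open_measurable3. Qed.
Let mV : measurable V. Proof. exact: open_measurable3. Qed.

(** Extended by 0 outside U, so as to be measurable everywhere. *)
Definition absdet : 'rV[R]_3 -> R := (fun x => `|\det ('J f x)|) \_ U.

Lemma absdet_ge0 x : 0 <= absdet x.
Proof. by rewrite /absdet /patch; case: ifP. Qed.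

Lemma absdetE x : U x -> absdet x = `|\det ('J f x)|.
Proof. by move=> Ux; rewrite /absdet patchT// inE. Qed.

Let absdet_cont x : U x -> {for x, continuous (fun x => `|\det ('J f x)|)}.
Proof.
move=> Ux; apply: (@continuous_comp _ _ _ (fun y => \det ('J f y)) (fun r : R => `|r|)).
  by apply: det_continuous; exact: Jc.
exact: norm_continuous.
Qed.

Lemma measurable_absdet : measurable_fun setT absdet.
Proof.
have h := continuous_measurable_on oU absdet_cont.
exact: ((measurable_restrictT _ mU).1 h).
Qed.

Let mg0 : measurable_fun setT (g \_ V).
Proof.
have h : measurable_fun V g.
  apply: continuous_measurable_row => // y Vy.
  by apply: differentiable_continuous; exact: dg.
exact: ((measurable_restrictT _ mV).1 h).
Qed.

(** The measure [E |-> vol (f @` E)], for f the inverse of g: as the direct image of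
    volume by g, it is a measure by construction, and images need not be discussed. *)
Definition image_measure : {measure set 'rV[R]_3 -> \bar R} :=
  pushed_measure (restricted (@vol R) mV) mg0.

Lemma image_measureE E : image_measure E = vol (V `&` g @^-1` E).
Proof.
change (vol ((g \_ V) @^-1` E `&` V) = vol (V `&` g @^-1` E)); congr vol.
apply/seteqP; split => y /= [h1 h2]; split => //.
  by rewrite /patch mem_set in h1.
by rewrite /patch mem_set.
Qed.

Definition jacobian_measure : {measure set 'rV[R]_3 -> \bar R} :=
  density (@vol R) measurable_absdet absdet_ge0.

Let box_vol (a b : 'rV[R]_3) := \prod_i (b 0 i - a 0 i).

(** By continuity of the Jacobian determinant. *)
Lemma local_jacobian_measure x (e : R) : U x -> 0 < e ->
  exists2 r : R, 0 < r & forall a b (s : R), 0 < s < r ->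
    (forall i, a 0 i <= x 0 i <= b 0 i) ->
    (forall i, b 0 i - a 0 i <= s) ->
    (((`|\det ('J f x)| - e / 2) * box_vol a b)%R%:E <= jacobian_measure (box a b))%E /\
    (jacobian_measure (box a b) <=
      ((`|\det ('J f x)| + e / 2) * box_vol a b)%R%:E)%E.
Proof.
move=> Ux e0; set D := `|\det _|.
have /nbhs_ballP[r /= r0 hr] : \forall z \near x, U z /\ `| `|\det ('J f z)| - D| < e / 2.
  have e20 : 0 < e / 2 by rewrite divr_gt0.
  near=> z; split; first by near: z; exact: open_nbhs_nbhs.
  rewrite distrC; near: z.
  by have /cvgrPdist_lt/(_ _ e20) := absdet_cont Ux.
exists r => // a b s /andP[s0 sr] hx hs.
have ab i : a 0 i <= b 0 i by have := hx i; lra.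
have hz z : box a b z -> D - e / 2 <= absdet z <= D + e / 2.
  move=> abz; have : ball x r z.
    rewrite -ball_normE/= distrC; apply: le_lt_trans sr.
    by apply: closed_box_norm hx _ hs => j; have /andP[-> /ltW ->] := abz j.
  by move=> /hr[Uz]; rewrite absdetE// ltr_norml; lra.
have mb := measurable_box a b.
have cstE c : (\int[@vol R]_(z in box a b) (cst c%:E z) = (c * box_vol a b)%R%:E)%E.
  by rewrite integral_cst//= vol_box// EFinM.
split.
- have [D0|D0] := leP 0 (D - e / 2); last first.
    apply: (@le_trans _ _ 0%E); last exact: measure_ge0.
    rewrite lee_fin; apply: mulr_le0_ge0; first exact: ltW.
    by apply: prodr_ge0 => i _; rewrite subr_ge0.
  rewrite -cstE; apply: ge0_le_integral => //.
  - by apply/measurable_EFinP; apply: measurable_funTS; exact: measurable_absdet.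
  - by move=> z /hz /andP[h _]; rewrite lee_fin.
- rewrite -cstE; apply: ge0_le_integral => //.
  - by move=> z _; rewrite lee_fin absdet_ge0.
  - by apply/measurable_EFinP; apply: measurable_funTS; exact: measurable_absdet.
  - by move=> z /hz /andP[_ h]; rewrite lee_fin.
Unshelve. all: by end_near. Qed.

(** By bisection, applied to the property that the two measures differ on a box by at
    most e times its volume.  This property is additive and holds near every point.
    So is finiteness, which is obtained along the way. *)
Lemma image_measure_box a b : (forall i, a 0 i < b 0 i) ->
  [set x : 'rV[R]_3 | forall i, a 0 i <= x 0 i <= b 0 i] `<=` U ->
  image_measure (box a b) = jacobian_measure (box a b) /\
  (image_measure (box a b) < +oo)%E.
Proof.
move=> ab abU.
have key (e : R) : 0 < e -> [/\
   (image_measure (box a b) <= jacobian_measure (box a b) + e%:E * vol (box a b))%E,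
   (jacobian_measure (box a b) <= image_measure (box a b) + e%:E * vol (box a b))%E &
   (image_measure (box a b) < +oo)%E].
  move=> e0; pose P (a b : 'rV[R]_3) := [/\
   (image_measure (box a b) <= jacobian_measure (box a b) + e%:E * vol (box a b))%E,
   (jacobian_measure (box a b) <= image_measure (box a b) + e%:E * vol (box a b))%E &
   (image_measure (box a b) < +oo)%E].
  apply: (@bisection R P) => [{abU}{}a {ab}b i c ac [h1 h2 h3] [k1 k2 k3]|i|x hx].
  - rewrite /P !(measure_box_cut _ ac) ge0_muleDr ?measure_ge0//.
    split; [| |exact: lte_add_pinfty h3 k3].
      by apply: le_trans (leeD h1 k1) _; rewrite addeACA.
    by apply: le_trans (leeD h2 k2) _; rewrite addeACA.
  - exact: ltW.
  (* m bounds the sides from below and S from above, hence the eccentricity m / S *)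
  pose m := Num.min (b 0 0 - a 0 0) (Num.min (b 0 1 - a 0 1) (b 0 2 - a 0 2)).
  have m0 : 0 < m by rewrite !lt_min !subr_gt0 !ab.
  have mab i : m <= b 0 i - a 0 i.
    by move: i; apply: ord3P; rewrite !ge_min lexx ?orbT.
  pose S := \sum_i (b 0 i - a 0 i).
  have Sab i : b 0 i - a 0 i <= S.
    rewrite /S (bigD1 i)//= lerDl sumr_ge0// => j _.
    by rewrite subr_ge0 ltW.
  have S0 : 0 < S by apply: lt_le_trans (Sab 0); apply: lt_le_trans (mab 0).
  have Ux : U x by exact: abU.
  have [r1 r10 h1] := local_jacobian_measure Ux e0.
  have [r2 r20 h2] := local_image_volume oU oV fUV fK gK df dg Ux (divr_gt0 m0 S0) e0.
  have r0 : 0 < Num.min r1 r2 by rewrite lt_min r10.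
  exists (Num.bound (S / Num.min r1 r2)) => n a' b' hn hab.
  have p2 : 0 < 2 ^+ n :> R by rewrite exprn_gt0.
  have sr : 0 < S / 2 ^+ n < Num.min r1 r2.
    rewrite divr_gt0//= ltr_pdivrMr// mulrC -ltr_pdivrMr//.
    apply: lt_le_trans (archi_boundP _) _; first by rewrite divr_ge0// ltW.
    by rewrite -natrX ler_nat (leq_trans hn)// ltnW// ltn_expl.
  have hx' i : a' 0 i <= x 0 i <= b' 0 i by have [_ -> -> _ _] := hab i.
  have ab' i : a' 0 i <= b' 0 i by have := hx' i; lra.
  have hs i : b' 0 i - a' 0 i <= S / 2 ^+ n.
    by have [_ _ _ _ ->] := hab i; rewrite ler_pM2r ?invr_gt0.
  have hs2 i : m / S * (S / 2 ^+ n) <= b' 0 i - a' 0 i <= S / 2 ^+ n.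
    rewrite hs andbT; have [_ _ _ _ ->] := hab i.
    by rewrite mulrA divfK ?gt_eqF// ler_pM2r ?invr_gt0.
  move: sr; rewrite lt_min => /and3P[s0 sr1 sr2].
  have [|lo1 up1] := h1 a' b' (S / 2 ^+ n) _ hx' hs; first by rewrite s0.
  have [|lo2 up2] := h2 a' b' (S / 2 ^+ n) _ hx' hs2; first by rewrite s0.
  rewrite -image_measureE in lo2 up2.
  set D := `|\det _| in lo1 lo2 up1 up2.
  have eqv : ((D + e / 2) * box_vol a' b' = (D - e / 2) * box_vol a' b' + e * box_vol a' b')%R.
    by field.
  rewrite /P vol_box// -EFinM; split.
  - by apply: le_trans up2 _; rewrite eqv EFinD leeD2r.
  - by apply: le_trans up1 _; rewrite eqv EFinD leeD2r.
  - by apply: le_lt_trans up2 _; rewrite ltry.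
have [_ _ fin] := key 1 ltr01; split => //.
have vp : 0 < box_vol a b by apply: prodr_gt0 => i _; rewrite subr_gt0.
have volE (d : R) : ((d / box_vol a b)%:E * vol (box a b) = d%:E)%E.
  rewrite vol_box -?EFinM ?divfK ?gt_eqF// => i; exact: ltW.
apply/eqP; rewrite eq_le; apply/andP; split; apply/lee_addgt0Pr => d d0.
  by have [h _ _] := key _ (divr_gt0 d0 vp); rewrite volE in h.
by have [_ h _] := key _ (divr_gt0 d0 vp); rewrite volE in h.
Qed.

(** The intersection of two boxes is a box, so that inside a fixed box contained in U
    the two measures agree on a generating pi-system. *)
Lemma image_measure_in_box a b E : (forall i, a 0 i < b 0 i) ->
  [set x : 'rV[R]_3 | forall i, a 0 i <= x 0 i <= b 0 i] `<=` U -> measurable E ->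
  image_measure (E `&` box a b) = jacobian_measure (E `&` box a b).
Proof.
move=> ab abU mE; have mb := measurable_box a b.
apply: (@boxes_unique R (restricted image_measure mb) (restricted jacobian_measure mb)) => // [c d cd|n].
- change (image_measure (box c d `&` box a b) = jacobian_measure (box c d `&` box a b)).
  rewrite boxI; set l := \row_i _; set u := \row_i _.
  have [lu|] := pselect (forall i, l 0 i < u 0 i).
    apply: (image_measure_box lu _).1 => x hx; apply: abU => i.
    by have := hx i; rewrite !mxE ge_max le_min => /andP[/andP[_ ->] /andP[_ ->]].
  move/existsNP => [i /negP]; rewrite -leNgt => ul.
  rewrite (_ : box l u = set0) ?measure0//.
  apply/seteqP; split => // x /(_ i) /andP[lx xu].
  by have := le_lt_trans lx (lt_le_trans xu ul); rewrite ltxx.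
- change (image_measure (ccube n `&` box a b) < +oo)%E.
  apply: le_lt_trans (image_measure_box ab abU).2; apply: le_measure; rewrite ?inE//.
  by apply: measurableI => //; exact: measurable_box.
Qed.

Theorem image_measure_jacobian E : measurable E -> image_measure E = jacobian_measure E.
Proof.
move=> mE.
have -> : image_measure E = image_measure (E `&` U).
  rewrite !image_measureE; congr vol; apply/seteqP; split => y [Vy gy] //.
    by do !split => //; exact: gVU.
  by case: gy.
have -> : jacobian_measure E = jacobian_measure (E `&` U).
  rewrite /jacobian_measure/= /density integral_mkcondr; apply: eq_integral => x _.
  rewrite patchE; case: ifPn => // xU; congr EFin.
  by rewrite /absdet /patch (negbTE xU).
have [D [DU hD]] := open_boxes oU; rewrite DU.
apply: measure_eq_bigcup => // [n|n F mF].
  by have [->|[a [b [_ -> _]]]] := hD n; [exact: measurable0|exact: measurable_box].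
have [->|[a [b [ab -> abU]]]] := hD n; first by rewrite setI0 !measure0.
exact: image_measure_in_box.
Qed.

End image_measure_jacobian.

(** * Change of variables for integrals *)

(** Restricting a measure to V amounts to giving it the indicator of V as density. *)
Lemma ge0_integral_restricted d (T : measurableType d) (R : realType)
    (mu : {measure set T -> \bar R}) (D V : set T) (mV : measurable V) (k : T -> \bar R) :
  measurable D -> measurable_fun D k -> (forall x, D x -> 0 <= k x)%E ->
  (\int[restricted mu mV]_(x in D) k x = \int[mu]_(x in D `&` V) k x)%E.
Proof.
move=> mD mk k0.
have mi : measurable_fun setT (\1_V : T -> R) by [].
have i0 x : 0 <= (\1_V x : R) by [].
rewrite [LHS](@eq_measure_integral _ _ _ D (density mu mi i0)); last first.
  by move=> A mA _; rewrite /= /density integral_indic// /mrestr setIC.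
rewrite integral_density// integral_mkcondr; apply: eq_integral => x _.
by rewrite epatch_indic.
Qed.

Section integral_diffeo.
Variable R : realType.

Variables (U V : set 'rV[R]_3) (f g : 'rV[R]_3 -> 'rV[R]_3).
Hypotheses (oU : open U) (oV : open V).
Hypotheses (fUV : forall x, U x -> V (f x)) (gVU : forall y, V y -> U (g y)).
Hypotheses (fK : forall x, U x -> g (f x) = x) (gK : forall y, V y -> f (g y) = y).
Hypotheses (df : forall x, U x -> differentiable f x)
           (dg : forall y, V y -> differentiable g y).
Hypothesis (Jc : forall x, U x -> {for x, continuous (fun y => 'J f y)}).

Let mU : measurable U. Proof. exact: open_measurable3. Qed.
Let mV : measurable V. Proof. exact: open_measurable3. Qed.

Let measurable_f : measurable_fun U f.
Proof.
apply: continuous_measurable_row => // x Ux.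
by apply: differentiable_continuous; exact: df.
Qed.

Let measurable_comp_f (d : measure_display) (T : measurableType d)
    (h : 'rV[R]_3 -> T) : measurable_fun V h -> measurable_fun U (h \o f).
Proof.
move=> mh; apply: (measurable_comp mV _ mh measurable_f).
by move=> _ [x Ux <-]; exact: fUV.
Qed.

(** With k = h o f, the left side is the integral of k with respect to the image
    measure, the right side that with respect to the measure with density |det Df|. *)
Theorem ge0_integral_diffeo (h : 'rV[R]_3 -> \bar R) :
  measurable_fun V h -> (forall y, V y -> 0 <= h y)%E ->
  (\int[@vol R]_(y in V) h y =
   \int[@vol R]_(x in U) (h (f x) * (absdet U f x)%:E))%E.
Proof.
move=> mh h0.
have mhf : measurable_fun U (h \o f) by exact: measurable_comp_f.
have hf0 x : U x -> (0 <= (h \o f) x)%E by move=> Ux; exact/h0/fUV.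
have mg : measurable_fun setT (g \_ V).
  have mg : measurable_fun V g.
    apply: continuous_measurable_row => // y Vy.
    by apply: differentiable_continuous; exact: dg.
  exact: ((measurable_restrictT _ mV).1 mg).
have mgU : measurable ((g \_ V) @^-1` U).
  by rewrite -[X in measurable X]setTI; exact: mg.
transitivity (\int[restricted (@vol R) mV]_(y in (g \_ V) @^-1` U) ((h \o f) \o (g \_ V)) y)%E.
  rewrite ge0_integral_restricted//; last 2 first.
  - apply: (measurable_comp mU) => //; first by move=> _ [y Uy <-].
    exact: (measurable_funTS mg).
  - by move=> y Uy; exact: hf0.
  rewrite (_ : _ `&` V = V); last first.
    by apply/seteqP; split => y /= => [[]//|Vy]; split => //; rewrite patchT ?inE//; exact: gVU.
  by apply: eq_integral => y /[!inE] Vy; rewrite /= patchT ?inE// gK.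
transitivity (\int[image_measure oV dg]_(x in U) (h \o f) x)%E.
  symmetry; apply: (@ge0_integral_pushforward _ _ _ _ _ _ mg (restricted (@vol R) mV) U (h \o f)) => //.
  by move=> x /[!inE]; exact: hf0.
transitivity (\int[jacobian_measure oU Jc]_(x in U) (h \o f) x)%E.
  by apply: eq_measure_integral => A mA _; exact: (image_measure_jacobian oU oV fUV gVU fK gK df dg Jc mA).
exact: (integral_density (@vol R) (measurable_absdet oU Jc) (absdet_ge0 U f) hf0 mU mhf).
Qed.

Theorem integral_diffeo (h : 'rV[R]_3 -> R) : measurable_fun V h ->
  (\int[@vol R]_(y in V) (h y)%:E =
   \int[@vol R]_(x in U) (h (f x) * absdet U f x)%:E)%E.
Proof.
move=> mh; have mEh : measurable_fun V (EFin \o h) by exact/measurable_EFinP.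
rewrite [LHS]integralE [RHS]integralE; congr (_ - _)%E.
- rewrite ge0_integral_diffeo//; last exact: measurable_funepos.
  apply: eq_integral => x _; rewrite !funeposE /= -!EFin_max -EFinM; congr EFin.
  by rewrite maxr_pMl ?mul0r// absdet_ge0.
- rewrite ge0_integral_diffeo//; last exact: measurable_funeneg.
  apply: eq_integral => x _; rewrite !funenegE /= -!EFin_max -EFinM; congr EFin.
  by rewrite maxr_pMl ?mul0r ?mulNr// absdet_ge0.
Qed.

(** The image of a null set has the integral of |det Df| over this set as volume. *)
Lemma diffeo_null_image E : measurable E -> vol E = 0%E -> vol (V `&` g @^-1` E) = 0%E.
Proof.
move=> mE E0; rewrite -(image_measureE oV dg) (image_measure_jacobian oU oV fUV gVU fK gK df dg Jc mE).
rewrite /jacobian_measure/= /density; apply: null_set_integral => //.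
apply: measurable_funTS; apply/measurable_EFinP; exact: measurable_absdet.
Qed.

End integral_diffeo.

(** * Diffeomorphisms defined on a set that need not be open *)

Section germs.
Variable R : realType.

Implicit Types f h : 'rV[R]_3 -> 'rV[R]_3.

(** A first-order expansion determines the differential, and it depends on the germ
    only. *)
Lemma near_eq_differential f h x : (\forall y \near x, f y = h y) ->
  differentiable h x -> differentiable f x /\ 'd f x = 'd h x :> ('rV[R]_3 -> 'rV[R]_3).
Proof.
move=> fh dh; have fhx : f x = h x by exact: nbhs_singleton fh.
have exp : f \o shift x = cst (f x) + 'd h x +o_ 0 id.
  apply/eqaddoP => e e0; have /diff_locally/eqaddoP/(_ e e0) H := dh.
  have fh0 : \forall z \near (0 : 'rV[R]_3), f (z + x) = h (z + x).
    move: fh => /nbhs_ballP[r /= r0 hr]; apply/nbhs_ballP; exists r => //= z.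
    by rewrite -ball_normE/= sub0r => zr; apply: hr; rewrite -ball_normE/= opprD addrCA subrr addr0.
  apply: filterS2 H fh0 => z hz fz; apply: le_trans hz.
  rewrite le_eqVlt; apply/orP; left; apply/eqP; congr `|_|.
  rewrite -[LHS]/(f (z + x) - (f x + 'd h x z)) -[RHS]/(h (z + x) - (h x + 'd h x z)).
  by rewrite fz fhx.
have ch : continuous ('d h x) by apply: diff_continuous.
have dE : 'd f x = 'd h x :> ('rV[R]_3 -> 'rV[R]_3).
  exact: (@diff_unique R 'rV[R]_3 'rV[R]_3 f ('d h x) x ch exp).
split; last exact: dE.
apply/(diff_locallyP x f); split; first by rewrite dE; exact: ch.
by apply/eqaddoP; rewrite dE; exact/eqaddoP.
Qed.

Lemma near_eq_jacobian f h x : (\forall y \near x, f y = h y) ->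
  differentiable h x -> 'J f x = 'J h x.
Proof.
move=> fh dh; have [df dE] := near_eq_differential fh dh.
exact: (congr1 (@lin1_mx R 3 3) dE).
Qed.

Lemma C1_germ (U : set 'rV[R]_3) f h x : open U -> U x -> (forall y, U y -> f y = h y) ->
  (forall y, U y -> differentiable h y) -> {for x, continuous (fun y => 'J h y)} ->
  [/\ differentiable f x, 'J f x = 'J h x & {for x, continuous (fun y => 'J f y)}].
Proof.
move=> oU Ux fh dh ch.
have near_fh y : U y -> \forall z \near y, f z = h z.
  by move=> Uy; apply: filterS fh _; exact: open_nbhs_nbhs.
have JE y : U y -> 'J f y = 'J h y.
  by move=> Uy; apply: near_eq_jacobian; [exact: near_fh|exact: dh].
split; [|exact: JE|].
  by have [] := near_eq_differential (near_fh _ Ux) (dh _ Ux).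
have JEx := JE _ Ux.
have nJ : \forall y \near x, 'J h y = 'J f y.
  near=> y.
  symmetry.
  apply: JE.
  near: y.
  apply: open_nbhs_nbhs.
  split.
    exact: oU.
  exact: Ux.
rewrite /prop_for /continuous_at [X in _ --> X]JEx.
move=> P hP; have hP' := ch P hP.
apply: (filterS2 _ _ nJ hP').
by move=> y /= ->.
Unshelve. all: by end_near. Qed.

End germs.

Section diffeo.
Variable R : realType.

Implicit Types (A : set 'rV[R]_3) (f : 'rV[R]_3 -> 'rV[R]_3).

Lemma diffeo_image A f E : or_diffeo_on A f -> E `<=` A ->
  (open E -> open (f @` E)) /\
  (measurable E -> vol E = 0%E -> measurable (f @` E) /\ vol (f @` E) = 0%E).
Proof.
move=> [ft [g [U [V [[oU oV AU] [cf cg fUV gVU] fK gK Af]]]]] EA.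
have fE : f @` E = V `&` g @^-1` E.
  apply/seteqP; split => [_ [x Ex <-]|y [Vy gy]].
    have [<- _] := Af _ (EA _ Ex); split => /=; first exact/fUV/AU/EA.
    by rewrite fK// inE; exact/AU/EA.
  exists (g y) => //; have [<- _] := Af _ (EA _ gy).
  by rewrite gK// inE.
have dg y : V y -> differentiable g y by move=> /cg[].
rewrite fE; split => [oE|mE E0].
  apply: open_preimage => // y Vy.
  by apply: differentiable_continuous; exact: dg.
split; first exact: measurable_diffeo_image.
have cK x : U x -> g (ft x) = x by move=> Ux; rewrite fK// inE.
have cK' y : V y -> ft (g y) = y by move=> Vy; rewrite gK// inE.
have dft x : U x -> differentiable ft x by move=> /cf[].
have Jft x : U x -> {for x, continuous (fun y => 'J ft y)} by move=> /cf[].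
exact: (diffeo_null_image oU oV fUV gVU cK cK' dft dg Jft mE E0).
Qed.

(** On an open part of A, f coincides with its extension, and h with the inverse of
    the extension; so both inherit their derivatives. *)
Lemma diffeo_germ A f (h : 'rV[R]_3 -> 'rV[R]_3) (O : set 'rV[R]_3) : or_diffeo_on A f ->
  open O -> O `<=` A -> (forall x, O x -> h (f x) = x) ->
  [/\ forall x, O x -> differentiable f x,
      forall x, O x -> {for x, continuous (fun y => 'J f y)},
      forall x, O x -> 0 < \det ('J f x) &
      forall y, (f @` O) y -> differentiable h y].
Proof.
move=> dA oO OA hf; have [ofO _] := diffeo_image dA OA; move: dA.
move=> [ft [g [U [V [[oU oV AU] [cf cg fUV gVU] fK gK Af]]]]].
have ffE x : O x -> f x = ft x by move=> /OA /Af[->].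
have dft x : O x -> differentiable ft x by move=> /OA/AU/cf[].
have germ x : O x -> [/\ differentiable f x, 'J f x = 'J ft x & {for x, continuous (fun y => 'J f y)}].
  by move=> Ox; apply: (@C1_germ _ O) => //; have [] := cf _ (AU _ (OA _ Ox)).
split.
- by move=> x /germ[].
- by move=> x /germ[].
- by move=> x Ox; have [_ -> _] := germ _ Ox; have [_] := Af _ (OA _ Ox).
move=> y fOy.
have hg z : (f @` O) z -> h z = g z.
  by move=> [x Ox <-]; rewrite hf// ffE// fK// inE; exact/AU/OA.
have Vy : V y by move: fOy => [x Ox <-]; rewrite ffE//; exact/fUV/AU/OA.
have dgy : differentiable g y by have [] := cg _ Vy.
have nhg : \forall z \near y, h z = g z.
  by apply: (filterS hg); apply: open_nbhs_nbhs; split; [exact: ofO|].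
by have [] := near_eq_differential nhg dgy.
Qed.

End diffeo.

(** * Null sets and the reference tetrahedron *)

Lemma negligible_bigcup_fin d (T : measurableType d) (R : realType)
    (mu : {measure set T -> \bar R}) (I : finType) (F : I -> set T) :
  (forall i, mu.-negligible (F i)) -> mu.-negligible (\bigcup_i F i).
Proof.
move=> nF.
have : mu.-negligible (\bigcup_n (if unpickle n is Some i then F i else set0)).
  apply: negligible_bigcup => n; case: unpickle => [i|]; first exact: nF.
  exact: negligible_set0.
apply: negligibleS => x [i _ Fix].
by exists (pickle i) => //; rewrite pickleK.
Qed.

Lemma integral_null_diff d (T : measurableType d) (R : realType)
    (mu : {measure set T -> \bar R}) (A B : set T) (f : T -> \bar R) :
  measurable A -> measurable B -> A `<=` B -> mu (B `\` A) = 0%E ->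
  measurable_fun B f -> (\int[mu]_(x in B) f x = \int[mu]_(x in A) f x)%E.
Proof.
move=> mA mB AB BA0 mf.
have key (k : T -> \bar R) : measurable_fun B k -> (forall x, 0 <= k x)%E ->
    (\int[mu]_(x in B) k x = \int[mu]_(x in A) k x)%E.
  move=> mk k0; rewrite (@ge0_negligible_integral _ _ _ _ B (B `\` A))//; last exact: measurableD.
  by rewrite setDD setIidr.
rewrite integralE [RHS]integralE; congr (_ - _)%E.
  by apply: key; [exact: measurable_funepos|exact: funepos_ge0].
by apply: key; [exact: measurable_funeneg|exact: funeneg_ge0].
Qed.

Section reference_tetrahedron.
Variable R : realType.

Lemma continuous_bary (i : 'I_4) : continuous (fun x : 'rV[R]_3 => bary x i).
Proof.
move=> x; rewrite /bary; case: (unlift ord0 i) => [j|]; first exact: coord_continuous.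
apply: continuousB; first exact: cst_continuous.
by apply: continuous_sum_at => j; exact: coord_continuous.
Qed.

Definition Khat_interior : set 'rV[R]_3 := [set x | forall i, 0 < bary x i].

Lemma open_Khat_interior : open Khat_interior.
Proof.
rewrite openE => x Kx; rewrite /interior.
have near_i i : \forall y \near x, 0 < bary y i.
  by have /cvgr_gt := @continuous_bary i x; apply; exact: Kx.
exact: (filter_forall _ near_i).
Qed.

Lemma measurable_bary i : measurable_fun setT (fun x : 'rV[R]_3 => bary x i).
Proof.
apply: continuous_measurable_on => [|x _]; first exact: openT.
exact: continuous_bary.
Qed.

Lemma measurable_Khat : measurable (@Khat R).
Proof.
rewrite (_ : Khat (R:=R) = \bigcap_(i : 'I_4)
  (setT `&` (fun x : 'rV[R]_3 => bary x i) @^-1` `[0, +oo[%classic)).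
  by apply: fin_bigcap_measurable => // i _; exact: measurable_bary.
apply/seteqP; split => x /= h i.
  by split => //=; rewrite in_itv/= andbT.
by have [_] := h i Logic.I; rewrite /= in_itv/= andbT.
Qed.

(** The oblique face is the preimage of a coordinate plane by the linear map that
    replaces the last coordinate by the sum of the coordinates. *)
Lemma face_null (i : 'I_4) : (@vol R).-negligible [set x : 'rV[R]_3 | bary x i = 0].
Proof.
rewrite /bary; case: (unlift ord0 i) => [j|].
  by have [mp p0] := vol_plane j (0 : R); apply/negligibleP.
have [mp p0] := vol_plane 2 (1 : R).
pose A : 'M[R]_3 := column_replacement 2 (fun=> 1).
have mE : measurable ((fun x => x *m A) @^-1` [set x : 'rV[R]_3 | x 0 2 = 1]).
  by rewrite -[X in measurable X]setTI; exact: measurable_mulmx.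
have xAE (x : 'rV[R]_3) : (x *m A) 0 2 = \sum_j x 0 j.
  by rewrite mxE; apply: eq_bigr => j _; rewrite mxE eqxx mulr1.
have := @scales_volume_column_replacement2 R (fun=> 1) (oner_neq0 _) _ mp.
rewrite p0 det_column_replacement2 normr1 mul1e => /(negligibleP _ mE).2; apply: negligibleS.
by move=> x /= /eqP; rewrite xAE subr_eq0 => /eqP.
Qed.

(** The boundary is contained in the union of the four planes that carry the faces. *)
Lemma boundary_null : measurable (@Khat R `\` Khat_interior) /\ vol (@Khat R `\` Khat_interior) = 0%E.
Proof.
have mb : measurable (@Khat R `\` Khat_interior).
  apply: measurableD; first exact: measurable_Khat.
  by apply: open_measurable3; exact: open_Khat_interior.
split => //; apply/negligibleP => //.
apply: negligibleS (negligible_bigcup_fin face_null) => x [Kx /existsNP[i xi]].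
exists i => //=; apply/eqP; rewrite eq_le Kx andbT leNgt; exact/negP.
Qed.

End reference_tetrahedron.

(** * Transport of integrals by the flow map *)

(** Null sets of triples and of row vectors correspond through [pt3]. *)
Lemma ae_on_vol (R : realType) (Om : set 'rV[R]_3) (P : 'rV[R]_3 -> Prop) :
  ae_on Om P -> {ae @vol R, forall x, Om x -> P x}.
Proof.
move=> [B [mB B0 hB]]; exists (@un3 R @^-1` B).
have pre : @pt3 R @^-1` (@un3 R @^-1` B) = B.
  by apply/seteqP; split => p /=; rewrite pt3K.
split.
- by rewrite /measurable/= /measurable_row3_set/= pre.
- by rewrite /vol /pushforward pre.
- by move=> x /= nP; apply: hB => /=; rewrite un3K.
Qed.

Section flow.
Variables (R : realType) (k : nat) (Om : set 'rV[R]_3) (m : nat).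
Variables (F : 'I_m -> 'rV[R]_3 -> 'rV[R]_3) (M : 'rV[R]_3 -> 'rV[R]_3).
Hypotheses (oOm : open Om) (hF : curvilinear_mesh k Om F) (hM : flow_map k Om F M).

(** The points interior to an element: the flow map is C^1 there, and they make up
    almost all of the domain. *)
Definition smooth_part : set 'rV[R]_3 := \bigcup_K (Om `&` F K @` @Khat_interior R).

Let h := pinv (closure Om) M.

Lemma flow_map_inj x y : closure Om x -> closure Om y -> M x = M y -> x = y.
Proof.
have [_ [L L0 hL] _ _] := hM.
move=> Ox Oy Mxy; have /andP[+ _] := hL _ _ Ox Oy.
rewrite Mxy subrr normr0 pmulr_rle0 ?invr_gt0// normr_le0 subr_eq0.
by move=> /eqP.
Qed.

Lemma flow_invK x : closure Om x -> h (M x) = x.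
Proof.
move=> Ox; apply: pinvKV; rewrite ?inE// => y z /[!inE] Oy Oz.
exact: flow_map_inj.
Qed.

(** The lower bi-Lipschitz bound says that the inverse is Lipschitz. *)
Lemma continuous_flow_inv y : (M @` Om) y -> {for y, continuous h}.
Proof.
have [_ [L L0 hL] oMOm _] := hM.
move=> MOy P /nbhs_ballP[e /= e0 eP].
have nb : nbhs y (M @` Om `&` ball y (e / L)).
  by apply: filterI; [exact: open_nbhs_nbhs|apply: nbhsx_ballx; rewrite divr_gt0].
apply: filterS nb => z [[x' Ox' xz]]; rewrite -ball_normE/= => yz.
have [x Ox xy] := MOy.
have cx : closure Om x by exact: subset_closure.
have cx' : closure Om x' by exact: subset_closure.
apply: eP; rewrite -ball_normE/= -xy -xz !flow_invK//.
have /andP[+ _] := hL _ _ cx cx'.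
rewrite mulrC ler_pdivrMr// => /le_lt_trans; apply.
by rewrite xy xz -ltr_pdivlMr.
Qed.

Let interior_sub : @Khat_interior R `<=` @Khat R.
Proof. by move=> x Kx i; exact: ltW. Qed.

Let diffF K : or_diffeo_on (@Khat R) (F K). Proof. by have [_ + _ _] := hF; exact. Qed.
Let diffM K : or_diffeo_on (F K @` @Khat R) M. Proof. by have [_ _ _ +] := hM; exact. Qed.

Let part K := Om `&` F K @` @Khat_interior R.

Let open_part K : open (part K).
Proof.
apply: openI => //.
by apply: (diffeo_image (diffF K) interior_sub).1; exact: open_Khat_interior.
Qed.

Let part_sub K : part K `<=` F K @` @Khat R.
Proof. by move=> _ [_ [z Kz <-]]; exists z => //; exact: interior_sub. Qed.

Let part_inv K x : part K x -> h (M x) = x.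
Proof. by move=> [Ox _]; apply: flow_invK; exact: subset_closure. Qed.

Lemma smooth_part_sub : smooth_part `<=` Om.
Proof. by move=> x [K _ []]. Qed.

Lemma open_smooth_part : open smooth_part.
Proof. by apply: bigcup_open => K _; exact: (@open_part K). Qed.

Lemma image_smooth_part : M @` smooth_part = \bigcup_K (M @` part K).
Proof. by rewrite /smooth_part image_bigcup. Qed.

Lemma open_image_smooth_part : open (M @` smooth_part).
Proof.
rewrite image_smooth_part; apply: bigcup_open => K _.
exact: ((diffeo_image (diffM K) (@part_sub K)).1 (@open_part K)).
Qed.

(** C^1 regularity is local, so that the elements can be treated one at a time; only
    the inverse, which is global, uses that M is injective on the whole domain. *)
Lemma flow_germ :
  [/\ forall x, smooth_part x -> differentiable M x,
      forall x, smooth_part x -> {for x, continuous (fun y => 'J M y)},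
      forall x, smooth_part x -> 0 < \det ('J M x) &
      forall y, (M @` smooth_part) y -> differentiable h y].
Proof.
have germ K := diffeo_germ (diffM K) (@open_part K) (@part_sub K) (@part_inv K).
split.
- by move=> x [K _ Kx]; have [d _ _ _] := germ K; exact: d.
- by move=> x [K _ Kx]; have [_ d _ _] := germ K; exact: d.
- by move=> x [K _ Kx]; have [_ _ d _] := germ K; exact: d.
- by rewrite image_smooth_part => y [K _ Ky]; have [_ _ _ d] := germ K; exact: d.
Qed.

Let null_skeleton : (@vol R).-negligible (\bigcup_K (F K @` (@Khat R `\` @Khat_interior R))) /\
  (@vol R).-negligible (\bigcup_K (M @` (F K @` (@Khat R `\` @Khat_interior R)))).
Proof.
have [mb b0] := boundary_null R.
have bK : @Khat R `\` @Khat_interior R `<=` @Khat R by move=> x [].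
have nF K := (diffeo_image (diffF K) bK).2 mb b0.
split; apply: negligible_bigcup_fin => K; have [mFK FK0] := nF K.
  exact: ((negligibleP _ mFK).2 FK0).
have sub : F K @` (@Khat R `\` @Khat_interior R) `<=` F K @` @Khat R by exact: image_subset.
have [mMK MK0] := (diffeo_image (diffM K) sub).2 mFK FK0.
exact: ((negligibleP _ mMK).2 MK0).
Qed.

Let not_smooth x : Om x -> ~ smooth_part x ->
  (\bigcup_K (F K @` (@Khat R `\` @Khat_interior R))) x.
Proof.
move=> Ox nsx; have [_ _ cO _] := hF.
have : closure Om x by exact: subset_closure.
rewrite cO => -[K _ [z Kz zx]]; exists K => //; exists z => //; split => // Kz'.
by apply: nsx; exists K => //; split => //; exists z.
Qed.

Let mOm : measurable Om. Proof. exact: open_measurable3. Qed.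
Let mS : measurable smooth_part. Proof. exact: (open_measurable3 open_smooth_part). Qed.
Let oMOm : open (M @` Om). Proof. by have [_ _ + _] := hM. Qed.

Lemma smooth_part_full : vol (Om `\` smooth_part) = 0%E.
Proof.
apply: (negligibleP _ (measurableD mOm mS)).1.
apply: negligibleS null_skeleton.1 => x [Ox nx].
exact: not_smooth.
Qed.

Lemma image_smooth_part_full : vol (M @` Om `\` M @` smooth_part) = 0%E.
Proof.
have mD := measurableD (open_measurable3 oMOm) (open_measurable3 open_image_smooth_part).
apply: (negligibleP _ mD).1.
apply: negligibleS null_skeleton.2 => _ [[x Ox <-] nMx].
have [|K _ Kx] := not_smooth Ox; first by move=> sx; apply: nMx; exists x.
by exists K => //; exists x.
Qed.

Lemma measurable_comp_flow_inv d (T : measurableType d) (f : 'rV[R]_3 -> T) :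
  measurable_fun Om f -> measurable_fun (M @` Om) (f \o h).
Proof.
move=> mf; apply: (measurable_comp mOm) => //.
  by move=> _ [_ [x Ox <-] <-]; rewrite flow_invK//; exact: subset_closure.
by apply: (continuous_measurable_row oMOm); exact: continuous_flow_inv.
Qed.

(** Both domains are replaced, up to null sets, by the smooth part and its image.
    There the Jacobian in the change of variables cancels the one in the density. *)
Theorem flow_transport (c0 c f : 'rV[R]_3 -> R) :
  measurable_fun Om c0 -> density_transported Om M c0 c -> measurable_fun Om f ->
  (\int[@vol R]_(y in M @` Om) (c y * f (h y))%:E =
   \int[@vol R]_(x in Om) (c0 x * f x)%:E)%E.
Proof.
move=> mc0 [mc cE] mf.
have mg : measurable_fun (M @` Om) (fun y => c y * f (h y)).
  apply: measurable_funM; first exact: mc.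
  exact: measurable_comp_flow_inv.
have mMS : measurable (M @` smooth_part) := open_measurable3 open_image_smooth_part.
have sub : M @` smooth_part `<=` M @` Om by apply: image_subset; exact: smooth_part_sub.
rewrite (integral_null_diff mMS (open_measurable3 oMOm) sub image_smooth_part_full); last first.
  exact/measurable_EFinP.
rewrite (integral_null_diff mS mOm smooth_part_sub smooth_part_full); last first.
  by apply/measurable_EFinP; exact: measurable_funM.
have [dM cJ dJ dh] := flow_germ.
have hS x : smooth_part x -> h (M x) = x by move=> [K _ /part_inv].
have MSS x : smooth_part x -> (M @` smooth_part) (M x) by move=> Sx; exists x.
have hMS y : (M @` smooth_part) y -> smooth_part (h y) by move=> [x Sx <-]; rewrite hS.
have MhS y : (M @` smooth_part) y -> M (h y) = y by move=> [x Sx <-]; rewrite hS.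
have mgS : measurable_fun (M @` smooth_part) (fun y => c y * f (h y)).
  exact: (measurable_funS (open_measurable3 oMOm) sub mg).
rewrite (integral_diffeo open_smooth_part open_image_smooth_part MSS hMS hS MhS dM dh cJ mgS).
have mM : measurable_fun smooth_part M.
  apply: (continuous_measurable_row open_smooth_part) => x Sx.
  by apply: differentiable_continuous; exact: dM.
apply: ae_eq_integral => //.
- apply/measurable_EFinP; apply: measurable_funM.
    apply: (@measurable_comp _ _ _ _ _ _ _ _ _ _ mMS _ mgS mM).
    by move=> _ [x Sx <-]; exact: MSS.
  by apply: measurable_funTS; exact: (measurable_absdet open_smooth_part cJ).
- apply/measurable_EFinP; apply: (measurable_funS mOm smooth_part_sub).
  exact: measurable_funM.
- have := ae_on_vol cE; apply: filterS => x cx Sx; congr EFin.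
  rewrite hS// cx; last exact: smooth_part_sub.
  rewrite absdetE// gtr0_norm ?dJ//.
  by rewrite mulrAC divfK// gt_eqF// dJ.
Qed.

End flow.

(** * Integrals over domains of space *)

Section integral3.
Variable R : realType.

Implicit Types (Om : set 'rV[R]_3) (f g : 'rV[R]_3 -> R).

Lemma ge0_integral_vol Om (k : 'rV[R]_3 -> \bar R) : measurable Om ->
  measurable_fun Om k -> (forall x, Om x -> 0 <= k x)%E ->
  (\int[@vol R]_(x in Om) k x = \int[@leb3 R]_(p in @pt3 R @^-1` Om) k (pt3 p))%E.
Proof.
move=> mOm mk k0.
rewrite -[RHS](@ge0_integral_pushforward _ _ _ _ _ _ (@measurable_pt3 R) (@leb3 R) Om k) //.
by move=> x /[!inE]; exact: k0.
Qed.

(** Only for measurable functions can the integral over triples be replaced by one over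
    row vectors: the positive and negative parts are transported separately. *)
Lemma integral3E Om f : measurable Om -> measurable_fun Om f ->
  integral3 Om f = \int[@vol R]_(x in Om) f x.
Proof.
move=> mOm mf; have mEf : measurable_fun Om (EFin \o f) by exact/measurable_EFinP.
rewrite /integral3 /Rintegral; congr fine.
rewrite [LHS]integralE [RHS]integralE; congr (_ - _)%E.
- rewrite [RHS]ge0_integral_vol//; last exact: measurable_funepos.
  by apply: eq_integral => p _; rewrite !funeposE.
- rewrite [RHS]ge0_integral_vol//; last exact: measurable_funeneg.
  by apply: eq_integral => p _; rewrite !funenegE.
Qed.

Lemma eq_integral3 Om f g : (forall x, Om x -> f x = g x) ->
  integral3 Om f = integral3 Om g.
Proof.
move=> fg; rewrite /integral3; apply: eq_Rintegral => p /[!inE] Op /=.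
exact: fg.
Qed.

Lemma integral3_ge0 Om f : (forall x, Om x -> 0 <= f x) -> 0 <= integral3 Om f.
Proof. by move=> f0; apply: Rintegral_ge0 => p Op; exact: f0. Qed.

Lemma integral3_0 Om : integral3 Om (fun=> 0) = 0.
Proof. by rewrite /integral3 /Rintegral integral0_eq. Qed.

(** If the positive and the negative part both have infinite integral, both sides
    are 0 by convention. *)
Lemma integral3N Om f : integral3 Om (fun x => - f x) = - integral3 Om f.
Proof.
pose D := @pt3 R @^-1` Om; pose G p := (f (@pt3 R p))%:E.
change (fine (\int[@leb3 R]_(p in D) (\- G) p)%E = - fine (\int[@leb3 R]_(p in D) G p)%E).
rewrite integralE [in RHS]integralE funeposN funenegN.
move: (integral _ _ _) (integral _ _ _) => [a| |] [b| |] //=; rewrite ?oppr0//.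
by rewrite opprB.
Qed.

(** Integrability is part of the conclusion to make the induction go through. *)
Lemma Rintegral_lin Om (I : Type) (r : seq I) (c : I -> R) (h : I -> 'rV[R]_3 -> R) :
  measurable Om -> (forall i, (@vol R).-integrable Om (EFin \o h i)) ->
  (@vol R).-integrable Om (EFin \o (fun x => \sum_(i <- r) c i * h i x)) /\
  \int[@vol R]_(x in Om) (\sum_(i <- r) c i * h i x) =
    \sum_(i <- r) c i * \int[@vol R]_(x in Om) h i x.
Proof.
move=> mOm ih; elim: r => [|i r [ir IH]].
  have -> : (fun x => \sum_(i <- [::]) c i * h i x) = cst 0.
    by apply/funext => x; rewrite big_nil.
  split; first exact: integrable0.
  by rewrite big_nil /Rintegral integral0_eq.
have -> : (fun x => \sum_(j <- i :: r) c j * h j x) =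
    (fun x => c i * h i x + \sum_(j <- r) c j * h j x).
  by apply/funext => x; rewrite big_cons.
have ici : (@vol R).-integrable Om (EFin \o (fun x => c i * h i x)).
  by have := integrableZl mOm (c i) (ih i).
split.
  by have := integrableD mOm ici ir.
by rewrite RintegralD// IH big_cons RintegralZl.
Qed.

End integral3.

(** * The Gram matrix as a weighted inner product *)

Section gram_form.
Variables (R : realType) (Om : set 'rV[R]_3).
Hypothesis mOm : measurable Om.
Implicit Types f g : 'rV[R]_3 -> R.

(** Dominated by [b * (f ^+ 2 + g ^+ 2)], where b bounds the weight. *)
Lemma weighted_product_integrable (c f g : 'rV[R]_3 -> R) : initial_coef Om c ->
  L2 Om f -> L2 Om g ->
  (@vol R).-integrable Om (EFin \o (fun x => c x * (f x * g x))).
Proof.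
move=> [mc [a [b [a0 cab]]]] [mf f2] [mg g2].
have mf' : measurable_fun Om f := mf.
have mg' : measurable_fun Om g := mg.
have mc' : measurable_fun Om c := mc.
have sq (u : 'rV[R]_3 -> R) : measurable_fun Om u ->
    (\int[@leb3 R]_(p in @pt3 R @^-1` Om) ((u (pt3 p)) ^+ 2)%:E < +oo)%E ->
    (@vol R).-integrable Om (EFin \o (fun x => u x ^+ 2)).
  move=> mu u2.
  have mu2 : measurable_fun Om (EFin \o (fun x => u x ^+ 2)).
    by apply/measurable_EFinP; exact: measurable_funX.
  apply/integrableP; split => //.
  rewrite ge0_integral_vol//; last by apply: measurableT_comp.
  rewrite (eq_integral (fun p => ((u (pt3 p)) ^+ 2)%:E))// => p _ /=.
  by rewrite ger0_norm// sqr_ge0.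
have dom : (@vol R).-integrable Om (EFin \o (fun x => b * (f x ^+ 2 + g x ^+ 2))).
  have := integrableZl mOm b (integrableD mOm (sq _ mf' f2) (sq _ mg' g2)).
  by [].
apply: le_integrable dom => //.
  apply/measurable_EFinP; apply: measurable_funM => //; exact: measurable_funM.
move=> x Ox /=; rewrite lee_fin; have /andP[ac cb] := cab _ Ox.
have b0 : 0 < b by lra.
rewrite [leRHS]ger0_norm; last by apply: mulr_ge0; [exact: ltW|rewrite addr_ge0 ?sqr_ge0].
rewrite normrM (ger0_norm (_ : 0 <= c x)); last lra.
apply: ler_pM => //; first lra.
rewrite ler_norml; nra.
Qed.

Variables (rho : 'rV[R]_3 -> R) (d : nat) (v : 'I_d -> 'rV[R]_3 -> 'rV[R]_3).
Hypothesis hrho : initial_coef Om rho.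
Hypothesis hv : forall j, L2_vec Om (v j).

Definition bilform n (Q : 'M[R]_n) (a b : 'cV[R]_n) : R := (a^T *m Q *m b) 0 0.

Definition lincomb (c : 'cV[R]_d) (x : 'rV[R]_3) : 'rV[R]_3 := \sum_j c j 0 *: v j x.

Let T (j i : 'I_d) (x : 'rV[R]_3) := rho x * dot (v j x) (v i x).

Let T_integrable j i : (@vol R).-integrable Om (EFin \o T j i).
Proof.
have := @Rintegral_lin R Om _ (index_enum 'I_3) (fun=> 1)
  (fun l x => rho x * (v j x 0 l * v i x 0 l)) mOm.
case=> [l|+ _].
  by apply: weighted_product_integrable; [exact: hrho|exact: hv|exact: hv].
congr (integrable _ _ _); apply/funext => x /=; congr EFin.
by rewrite /T /dot mulr_sumr; apply: eq_bigr => l _; rewrite mul1r.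
Qed.

Let lincombE (a b : 'cV[R]_d) x : rho x * dot (lincomb b x) (lincomb a x) =
  \sum_(p : 'I_d * 'I_d) (b p.1 0 * a p.2 0) * T p.1 p.2 x.
Proof.
rewrite -(pair_bigA _ (fun j i => (b j 0 * a i 0) * T j i x)) /=.
rewrite /dot mulr_sumr.
under [RHS]eq_bigr => j _ do under eq_bigr => i _ do rewrite /T /dot mulr_sumr mulr_sumr.
under [RHS]eq_bigr => j _ do rewrite exchange_big.
rewrite [RHS]exchange_big; apply: eq_bigr => l _ /=.
rewrite /lincomb !summxE mulr_suml mulr_sumr; apply: eq_bigr => j _.
rewrite mulr_sumr mulr_sumr; apply: eq_bigr => i _; rewrite !mxE; ring.
Qed.

Lemma lincomb_integrable (a b : 'cV[R]_d) :
  (@vol R).-integrable Om (EFin \o (fun x => rho x * dot (lincomb b x) (lincomb a x))).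
Proof.
have [+ _] := @Rintegral_lin R Om _ (index_enum ('I_d * 'I_d)%type)
  (fun p => b p.1 0 * a p.2 0) (fun p => T p.1 p.2) mOm (fun p => T_integrable p.1 p.2).
by congr (integrable _ _ _); apply/funext => x /=; rewrite lincombE.
Qed.

(** The Gram matrix represents the weighted inner product on combinations of the [v j]. *)
Lemma gram_formE (a b : 'cV[R]_d) :
  bilform (gram Om rho v) a b = \int[@vol R]_(x in Om) (rho x * dot (lincomb b x) (lincomb a x)).
Proof.
have [_ E] := @Rintegral_lin R Om _ (index_enum ('I_d * 'I_d)%type)
  (fun p => b p.1 0 * a p.2 0) (fun p => T p.1 p.2) mOm (fun p => T_integrable p.1 p.2).
transitivity (\int[@vol R]_(x in Om)
   (\sum_(p <- index_enum ('I_d * 'I_d)%type) b p.1 0 * a p.2 0 * T p.1 p.2 x)).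
  rewrite E -(pair_bigA _ (fun j i => b j 0 * a i 0 * \int[@vol R]_(x in Om) T j i x)) /=.
  rewrite /bilform mxE; apply: eq_bigr => j _.
  rewrite mxE mulr_suml; apply: eq_bigr => i _; rewrite !mxE.
  rewrite /ip_vec (_ : integral3 _ _ = \int[@vol R]_(x in Om) T j i x); first by ring.
  rewrite -integral3E//; last first.
    by apply/measurable_EFinP; exact: measurable_int (T_integrable j i).
  apply: eq_integral3 => x _; rewrite /T /dot mulr_sumr.
  by apply: eq_bigr => l _; rewrite mxE mulrA.
by apply: eq_Rintegral => x _; rewrite lincombE.
Qed.

Lemma gram_form_sym (a b : 'cV[R]_d) :
  bilform (gram Om rho v) a b = bilform (gram Om rho v) b a.
Proof.
rewrite !gram_formE; apply: eq_Rintegral => x _; congr (_ * _).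
by apply: eq_bigr => i _; rewrite mulrC.
Qed.

Lemma gram_form_ge0 (a : 'cV[R]_d) : 0 <= bilform (gram Om rho v) a a.
Proof.
rewrite gram_formE; apply: Rintegral_ge0 => x Ox.
have [_ [c [b [c0 cab]]]] := hrho; have /andP[cr _] := cab _ Ox.
rewrite mulr_ge0//; first lra.
by apply: sumr_ge0 => i _; rewrite -expr2 sqr_ge0.
Qed.

End gram_form.

Section bdf2_identity.
Variables (R : realType) (n : nat) (Q : 'M[R]_n).
Hypothesis symQ : forall a b, bilform Q a b = bilform Q b a.
Implicit Types a b c : 'cV[R]_n.

Lemma bilformDl a b c : bilform Q (a + b) c = bilform Q a c + bilform Q b c.
Proof. by rewrite /bilform linearD/= !mulmxDl mxE. Qed.

Lemma bilformZl (k : R) a b : bilform Q (k *: a) b = k * bilform Q a b.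
Proof. by rewrite /bilform linearZ/= -!scalemxAl mxE. Qed.

Lemma bilformNl a b : bilform Q (- a) b = - bilform Q a b.
Proof. by rewrite -scaleN1r bilformZl mulN1r. Qed.

(** The polarization behind the G-stability of BDF2: both sides have the same
    coefficients as quadratic forms in a, b, c. *)
Lemma bdf2_energy_identity a b c :
  2 * bilform Q a (3 *: a - 4 *: b + c) =
  (sqnorm Q a + sqnorm Q (2 *: a - b)) - (sqnorm Q b + sqnorm Q (2 *: b - c))
  + sqnorm Q (a - 2 *: b + c).
Proof.
rewrite -[sqnorm Q a]/(bilform Q a a) -[sqnorm Q b]/(bilform Q b b).
rewrite -[sqnorm Q (2 *: a - b)]/(bilform Q (2 *: a - b) (2 *: a - b)).
rewrite -[sqnorm Q (2 *: b - c)]/(bilform Q (2 *: b - c) (2 *: b - c)).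
rewrite -[sqnorm Q (a - 2 *: b + c)]/(bilform Q (a - 2 *: b + c) (a - 2 *: b + c)).
rewrite symQ !bilformDl !bilformNl !bilformZl.
rewrite !(symQ _ (_ - _)) !(symQ _ (_ + _)) !bilformDl !bilformNl !bilformZl.
rewrite (symQ b a) (symQ c a) (symQ c b); ring.
Qed.

End bdf2_identity.

(** Both sides are, up to sign, the determinant of u, b, w. *)
Lemma cross_antisym (R : realType) (u w b : 'rV[R]_3) :
  dot (cross u b) w = - dot (cross w b) u.
Proof.
rewrite /dot !sum_ord3 !mxE.
rewrite (_ : (0 : 'I_3) + 1 = 1); last exact/val_inj.
rewrite (_ : (0 : 'I_3) + 2 = 2); last exact/val_inj.
rewrite (_ : (1 : 'I_3) + 1 = 2); last exact/val_inj.
rewrite (_ : (1 : 'I_3) + 2 = 0); last exact/val_inj.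
rewrite (_ : (2 : 'I_3) + 1 = 0); last exact/val_inj.
rewrite (_ : (2 : 'I_3) + 2 = 1); last exact/val_inj.
ring.
Qed.

(** * The energy identity *)

Section energy_balance.
Variables (R : realType) (k : nat) (Om : set 'rV[R]_3) (m : nat).
Variables (F : 'I_m -> 'rV[R]_3 -> 'rV[R]_3) (M : 'rV[R]_3 -> 'rV[R]_3).

(** The scheme is tested with its own solution.  The contributions of phi and p vanish
    by the constraints, and the two Lorentz terms cancel. *)
Lemma fd_energy_balance (Re alpha beta : R) (B : 'rV[R]_3 -> 'rV[R]_3)
    (rho sigma nu : 'rV[R]_3 -> R) (f du J u : 'rV[R]_3 -> 'rV[R]_3)
    (phi p : 'rV[R]_3 -> R) :
  fd_solution k Om F M Re alpha beta B rho sigma nu f du J u phi p ->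
  ip_vec (M @` Om) (fun x => rho x *: du x) u
    + dissipation (M @` Om) Re alpha beta sigma nu J u =
  ip_vec (M @` Om) (fun x => rho x *: f x) u.
Proof.
move=> [[hJ hu hphi hp] ohm mom divJ divu].
have := ohm J hJ; have := mom u hu; have := divJ phi hphi; have := divu p hp.
have ipC g1 g2 : ip (M @` Om) g1 g2 = ip (M @` Om) g2 g1.
  by apply: eq_integral3 => x _; rewrite mulrC.
have crossE : ip_vec (M @` Om) (fun x => cross (J x) (B x)) u =
    - ip_vec (M @` Om) (fun x => cross (u x) (B x)) J.
  by rewrite -integral3N; apply: eq_integral3 => x _; exact: cross_antisym.
rewrite /ohm_eq /momentum_eq /dissipation crossE (ipC _ phi) (ipC _ p).
move=> /eqP; rewrite oppr_eq0 => /eqP -> /eqP; rewrite oppr_eq0 => /eqP ->.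
move=> <-; rewrite !subr0 => /eqP; rewrite subr_eq0 => /eqP ->.
by rewrite mulrN opprK !addrA.
Qed.

Lemma dissipation_ge0 (D : set 'rV[R]_3) (Re alpha beta : R)
    (sigma nu : 'rV[R]_3 -> R) (J u : 'rV[R]_3 -> 'rV[R]_3) :
  0 <= Re -> 0 <= alpha -> 0 <= beta ->
  (forall x, D x -> 0 <= sigma x) -> (forall x, D x -> 0 <= nu x) ->
  0 <= dissipation D Re alpha beta sigma nu J u.
Proof.
move=> Re0 a0 b0 s0 n0; rewrite /dissipation !addr_ge0//.
- rewrite mulr_ge0 ?invr_ge0//; apply: integral3_ge0 => x Dx.
  apply: sumr_ge0 => i _; apply: sumr_ge0 => j _; rewrite mxE -mulrA -expr2.
  by rewrite mulr_ge0 ?sqr_ge0// mulr_ge0// n0.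
- by rewrite mulr_ge0//; apply: integral3_ge0 => x Dx; rewrite -expr2 sqr_ge0.
- rewrite mulr_ge0//; apply: integral3_ge0 => x Dx.
  apply: sumr_ge0 => i _; rewrite mxE -mulrA -expr2.
  by rewrite mulr_ge0 ?sqr_ge0// invr_ge0 s0.
Qed.

End energy_balance.

Section transport.
Variables (R : realType) (k : nat) (Om : set 'rV[R]_3) (m : nat).
Variables (F : 'I_m -> 'rV[R]_3 -> 'rV[R]_3) (M u : nat -> 'rV[R]_3 -> 'rV[R]_3).
Hypothesis oOm : open Om.
Variables (Nu : nat) (v : 'I_Nu -> 'rV[R]_3 -> 'rV[R]_3) (xi : nat -> 'cV[R]_Nu).

(** Following the flow undoes the push-forward of the basis functions, so that the
    velocity at any time is read in the fixed basis. *)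
Lemma velocity_along_flow (n : nat) : flow_map k Om F (M n) ->
  (forall y, (M n @` Om) y -> u n y = \sum_j xi n j 0 *: pushed Om (M n) (v j) y) ->
  forall x, Om x -> u n (M n x) = lincomb v (xi n) x.
Proof.
move=> hM hu x Ox; rewrite hu; last by exists x.
apply: eq_bigr => j _; rewrite /pushed /= (flow_invK hM)//.
exact: subset_closure.
Qed.

Lemma transported_along_flow (a b : nat) : flow_map k Om F (M a) -> flow_map k Om F (M b) ->
  forall x, Om x -> transported Om M u b a (M b x) = u a (M a x).
Proof.
move=> ha hb x Ox.
have injO c : flow_map k Om F (M c) -> {in Om &, injective (M c)}.
  move=> hc y z /[!inE] Oy Oz.
  by apply: (flow_map_inj hc); exact: subset_closure.
have fb y : Om y -> flow_between Om M a b (M a y) = M b y.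
  by move=> Oy; rewrite /flow_between /= pinvKV ?inE//; exact: (injO _ ha).
have inj : {in M a @` Om &, injective (flow_between Om M a b)}.
  move=> _ _ /[!inE] -[y Oy <-] [z Oz <-]; rewrite (fb _ Oy) (fb _ Oz) => Mbyz.
  by congr (M a _); apply: (injO _ hb); rewrite ?inE.
rewrite /transported /= -(fb x Ox) (pinvKV _ inj)// inE.
by exists x.
Qed.

(** All three velocities in the difference quotient are evaluated along the same
    trajectory, hence are combinations of the same basis functions at the same point
    of the initial domain. *)
Lemma transported_kinetic (rho0 rho : 'rV[R]_3 -> R) (dt : R) (n : nat)
    (hF : curvilinear_mesh k Om F) :
  (0 < n)%N -> (forall i, (i <= n.+1)%N -> flow_map k Om F (M i)) ->
  (forall i, (i <= n.+1)%N -> forall y, (M i @` Om) y ->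
    u i y = \sum_j xi i j 0 *: pushed Om (M i) (v j) y) ->
  initial_coef Om rho0 -> density_transported Om (M n.+1) rho0 rho ->
  (forall j, L2_vec Om (v j)) ->
  ip_vec (M n.+1 @` Om) (fun x => rho x *: bdf2 Om M u dt n x) (u n.+1) =
  (2 * dt)^-1 * bilform (gram Om rho0 v) (xi n.+1) (3 *: xi n.+1 - 4 *: xi n + xi n.-1).
Proof.
move=> n0 hM hu hrho0 hrho hv.
have mOm : measurable Om by exact: open_measurable3.
pose a := xi n.+1; pose b := 3 *: xi n.+1 - 4 *: xi n + xi n.-1.
have hMn := hM n.+1 (leqnn _); have [_ _ oMOm _] := hMn.
have along i : (i <= n.+1)%N -> forall x, Om x -> u i (M i x) = lincomb v (xi i) x.
  by move=> ilen; apply: velocity_along_flow; [exact: hM|exact: hu].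
have mlincomb c l : measurable_fun Om (fun x => lincomb v c x 0 l).
  under eq_fun do (rewrite summxE; under eq_bigr do rewrite mxE).
  apply: measurable_sum => j; apply: measurable_funM => //.
  by have [] := hv j l.
pose g x := (2 * dt)^-1 * dot (lincomb v b x) (lincomb v a x).
have mg : measurable_fun Om g.
  apply: measurable_funM => //; apply: measurable_sum => l.
  by apply: measurable_funM; exact: mlincomb.
pose h := pinv (closure Om) (M n.+1).
have [mrho _] := hrho.
transitivity (integral3 (M n.+1 @` Om) (fun y => rho y * g (h y))).
  apply: eq_integral3 => _ [x Ox <-].
  rewrite /h (flow_invK hMn); last exact: subset_closure.
  have n1 : (n.-1 <= n.+1)%N by rewrite (leq_trans (leq_pred _)).
  rewrite /bdf2 !transported_along_flow//; [|exact: hM|exact: hM].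
  rewrite !along//.
  have -> : 3 *: lincomb v (xi n.+1) x - 4 *: lincomb v (xi n) x + lincomb v (xi n.-1) x = lincomb v b x.
    rewrite /lincomb !scaler_sumr -sumrB -big_split/=; apply: eq_bigr => j _.
    by rewrite !mxE !scalerA -scalerBl -scalerDl.
  by rewrite /g /dot !mulr_sumr; apply: eq_bigr => l _; rewrite !mxE !mulrA.
have mgh : measurable_fun (M n.+1 @` Om) (fun y => rho y * g (h y)).
  by apply: measurable_funM; [exact: mrho|exact: (measurable_comp_flow_inv oOm hMn mg)].
rewrite (integral3E (open_measurable3 oMOm) mgh) /Rintegral.
rewrite (flow_transport oOm hF hMn (_ : measurable_fun Om rho0) hrho mg); last by case: hrho0.
rewrite gram_formE// -[RHS]RintegralZl//; last exact: lincomb_integrable.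
by rewrite /Rintegral; congr fine; apply: eq_integral => x _; rewrite /g mulrCA.
Qed.

End transport.

Theorem theorem3p3 (R : realType)
  (* initial mesh *)
  (k : nat) (hk : (1 <= k)%N)
  (Om : set 'rV[R]_3) (hOm : lipschitz_domain Om)
  (m : nat) (F : 'I_m -> 'rV[R]_3 -> 'rV[R]_3) (hF : curvilinear_mesh k Om F)
  (* time grid *)
  (T : R) (hT : 0 < T) (N : nat) (hN : (0 < N)%N)
  (dt : R) (hdt : dt = T / N%:R)
  (* flow maps *)
  (M : nat -> 'rV[R]_3 -> 'rV[R]_3)
  (hM0 : forall x, closure Om x -> M 0%N x = x)
  (hM : forall n, (n <= N)%N -> flow_map k Om F (M n))
  (* coefficients and data *)
  (rho sigma nu : nat -> 'rV[R]_3 -> R)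
  (hrho0 : initial_coef Om (rho 0%N)) (hsigma0 : initial_coef Om (sigma 0%N))
  (hnu0 : initial_coef Om (nu 0%N))
  (hrho : forall n, (n <= N)%N -> density_transported Om (M n) (rho 0%N) (rho n))
  (hsigma : forall n, (n <= N)%N -> coef_transported Om (M n) (sigma 0%N) (sigma n))
  (hnu : forall n, (n <= N)%N -> coef_transported Om (M n) (nu 0%N) (nu n))
  (Re alpha beta : R) (hRe : 0 < Re) (halpha : 0 <= alpha) (hbeta : 0 < beta)
  (B : 'rV[R]_3 -> 'rV[R]_3) (hBm : meas_on_vec setT B)
  (hBb : exists C : R, forall x, `|B x| <= C)
  (fu : R -> 'rV[R]_3 -> 'rV[R]_3)
  (* discrete solution *)
  (J u : nat -> 'rV[R]_3 -> 'rV[R]_3) (phi p : nat -> 'rV[R]_3 -> R)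
  (hu0 : V0 k Om F (u 0%N)) (hu1 : Vn k Om F (M 1%N) (u 1%N))
  (hflow : forall n, (1 <= n < N)%N -> flow_step Om M u dt n)
  (hsol : forall n, (1 <= n < N)%N ->
     fd_solution k Om F (M n.+1) Re alpha beta B
       (rho n.+1) (sigma n.+1) (nu n.+1) (fu (n.+1%:R * dt))
       (bdf2 Om M u dt n) (J n.+1) (u n.+1) (phi n.+1) (p n.+1))
  (* velocity coefficients *)
  (Nu : nat) (v0 : 'I_Nu -> 'rV[R]_3 -> 'rV[R]_3)
  (hv0 : is_basis Om (V0 k Om F) v0)
  (xi : nat -> 'cV[R]_Nu)
  (hxi : forall n, (n <= N)%N -> forall y, (M n @` Om) y ->
     u n y = \sum_j xi n j 0 *: pushed Om (M n) (v0 j) y) :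
  let Q := gram Om (rho 0%N) v0 in
  let E := energy Q xi in
  let D n := dissipation (M n @` Om) Re alpha beta (sigma n) (nu n) (J n) (u n) in
  (forall n, (1 <= n < N)%N ->
     (E n.+1 - E n) / dt
     + (4 * dt)^-1 * sqnorm Q (xi n.+1 - 2 *: xi n + xi n.-1)
     + D n.+1
     = ip_vec (M n.+1 @` Om)
         (fun x => rho n.+1 x *: fu (n.+1%:R * dt) x) (u n.+1))
  /\
  ((forall t x, fu t x = 0) ->
     forall n, (1 <= n < N)%N ->
       (E n.+1 - E n) / dt + D n.+1 <= 0 /\ E n.+1 <= E n).

Proof.
have [oOm _ _ _ _] := hOm.
have dt0 : 0 < dt by rewrite hdt divr_gt0// ltr0n.
have hv j : L2_vec Om (v0 j).
  by have [+ _ _] := hv0 => /(_ j)[[hH1 _] _] l; have [] := hH1 l.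
move=> Q E D.
have symQ a b : bilform Q a b = bilform Q b a.
  by apply: gram_form_sym => //; exact: open_measurable3.
have Q0 a : 0 <= sqnorm Q a.
  by apply: gram_form_ge0 => //; exact: open_measurable3.
have balance n : (1 <= n < N)%N -> (E n.+1 - E n) / dt
     + (4 * dt)^-1 * sqnorm Q (xi n.+1 - 2 *: xi n + xi n.-1)
     + D n.+1
     = ip_vec (M n.+1 @` Om)
         (fun x => rho n.+1 x *: fu (n.+1%:R * dt) x) (u n.+1).
  move=> nN; have /andP[n0 ltnN] := nN.
  have iN i : (i <= n.+1)%N -> (i <= N)%N by move=> h; exact: leq_trans ltnN.
  rewrite -(fd_energy_balance (hsol _ nN)); congr (_ + _).
  have hMi i : (i <= n.+1)%N -> flow_map k Om F (M i) by move=> /iN; exact: hM.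
  have hui i : (i <= n.+1)%N -> forall y, (M i @` Om) y ->
      u i y = \sum_j xi i j 0 *: pushed Om (M i) (v0 j) y by move=> /iN; exact: hxi.
  rewrite (transported_kinetic oOm dt hF n0 hMi hui hrho0 (hrho _ ltnN) hv).
  have := bdf2_energy_identity symQ (xi n.+1) (xi n) (xi n.-1).
  rewrite /E /energy /= -/Q.
  move: (bilform _ _ _) (sqnorm _ _) (sqnorm _ _) (sqnorm _ _) (sqnorm _ _) (sqnorm _ _).
  move=> K x1 x2 x3 x4 x5 KE; have -> : K = (2 * K) / 2 by field.
  by rewrite KE; field; rewrite gt_eqF.
split => // fu0 n nN; have /andP[n0 ltnN] := nN.
have D0 : 0 <= D n.+1.
  have pos c0 c : initial_coef Om c0 -> coef_transported Om (M n.+1) c0 c ->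
      forall x, (M n.+1 @` Om) x -> 0 <= c x.
    move=> [_ [a [b [a0 cab]]]] [_ cE] _ [x Ox <-]; rewrite cE//.
    by have /andP[ac _] := cab _ Ox; rewrite (le_trans (ltW a0)).
  apply: dissipation_ge0; [exact: ltW|exact: halpha|exact: ltW| |].
  - exact: pos hsigma0 (hsigma _ ltnN).
  - exact: pos hnu0 (hnu _ ltnN).
have := balance n nN.
rewrite [X in _ = X -> _](_ : _ = 0); last first.
  rewrite -(integral3_0 (M n.+1 @` Om)); apply: eq_integral3 => x _.
  by rewrite fu0 scaler0 /dot big1// => i _; rewrite mxE mul0r.
have S0 : 0 <= (4 * dt)^-1 * sqnorm Q (xi n.+1 - 2 *: xi n + xi n.-1).
  by rewrite mulr_ge0// invr_ge0 mulr_ge0// ltW.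
move=> bal.
have le0 : (E n.+1 - E n) / dt + D n.+1 <= 0 by move: bal S0; lra.
split => //.
have : (E n.+1 - E n) / dt <= 0 by move: le0 D0; lra.
by rewrite pmulr_lle0 ?invr_gt0// subr_le0.
Qed.
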